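(* Let $X\in SO^{+}(4,1)$ have polar decomposition $X=VP$ ($V$ special orthogonal, $P$ positive definite, both in $SO^{+}(4,1)$). Let $Q\in so(4,1)$ be symmetric with $\mathrm{Exp}(Q)=P$, and suppose $V=\mathrm{Exp}(\hat Y)$ with $\hat Y=(Y_1+Y_2)\oplus0_{1\times1}$, where for some real $p_1,p_2,p_3,q_1,q_2,q_3$ $$Y_1=\begin{pmatrix} 0 & -p_1 & -p_2 & -p_3 \\ p_1 & 0 & -p_3 & p_2 \\ p_2 & p_3 & 0 & -p_1 \\ p_3 & -p_2 & p_1 & 0 \end{pmatrix},\qquad Y_2=\begin{pmatrix} 0 & q_1 & q_2 & q_3 \\ -q_1 & 0 & -q_3 & q_2 \\ -q_2 & q_3 & 0 & -q_1 \\ -q_3 & -q_2 & q_1 & 0 \end{pmatrix}.$$ (1) $\Lambda=\Psi_{4,1}^{-1}(Q)$ has the form $\Lambda=\begin{pmatrix} a_1 & b+\beta_1j+\beta_2k \\ b-\beta_1j-\beta_2k & -a_1 \end{pmatrix}$ with real $a_1,b,\beta_1,\beta_2$, and with $\lambda=\sqrt{a_1^2+b^2+\beta_1^2+\beta_2^2}$, $$\Phi_{4,1}^{-1}(P)=\left\{\pm\left[\cosh(\lambda)I_2+\frac{\sinh\lambda}{\lambda}\Lambda\right]\right\}.$$ (2) For $l=1,2$ let $A_l=\Psi_{4,1}^{-1}(Y_l\oplus0_{1\times1})=Z_l+W_lj\in M(2,\mathbf{H})$, and let $\kappa_l=2\sqrt{a_2^2+\alpha_1^2+\alpha_2^2}$,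 where $a_2,\alpha_1,\alpha_2$ are the parameters of $A_l$ in the parametrization of $\mathrm{spin}^{+}(4,1)$ given in the context. Then $$\Phi_{4,1}^{-1}(V)=\left\{\pm\left[I_2+\frac{\sin\kappa_1}{\kappa_1}A_1+\frac{1-\cos\kappa_1}{\kappa_1^2}A_1^2\right]\left[I_2+\frac{\sin\kappa_2}{\kappa_2}A_2+\frac{1-\cos\kappa_2}{\kappa_2^2}A_2^2\right]\right\}.$$ (When $\lambda=0$ or $\kappa_l=0$ the quotients are interpreted by their limits $1$, $1$, $\tfrac12$.)
   Context: $\mathbf{H}$ is the quaternions with units $i,j,k$ ($ij=k$). Every $A\in M(2,\mathbf{H})$ is uniquely $A=Z+Wj$ with $Z,W\in M(2,\mathbf{C})$; put $\Theta_{\mathbf{H}}(A)=\begin{pmatrix} Z & W \\ -\bar W & \bar Z \end{pmatrix}\in M(4,\mathbf{C})$, an injective real algebra homomorphism; $M(2,\mathbf{H})$ is identified with its image. Let $\sigma_x=\begin{pmatrix} 0 & 1 \\ 1 & 0 \end{pmatrix}$, $\sigma_y=\begin{pmatrix} 0 & -i \\ i & 0 \end{pmatrix}$, $\sigma_z=\mathrm{diag}(1,-1)$. The basis of one-vectors for $\mathrm{Cl}(4,1)=M(4,\mathbf{C})$ is $V_1=\sigma_z\otimes\sigma_x$, $V_2=-\sigma_y\otimes I_2$, $V_3=\sigma_z\otimes\sigma_z$, $V_4=\sigma_x\otimes I_2$, $V_5=-\sigma_z\otimes(i\sigma_y)$. $\mathrm{Spin}^{+}(4,1)=\{Y\in M(2,\mathbf{H}):\Theta_{\mathbf{H}}(Y)^{*}M\Theta_{\mathbf{H}}(Y)=M\}$,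 $M=(i\sigma_y)\oplus(-i\sigma_y)$. $\Phi_{4,1}:\mathrm{Spin}^{+}(4,1)\to SO^{+}(4,1)$ sends $Y$ to the real $5\times5$ matrix of $V\mapsto\Theta_{\mathbf{H}}(Y)V\Theta_{\mathbf{H}}(Y)^{-1}$ on $\mathrm{span}_{\mathbf{R}}\{V_1,\dots,V_5\}$ in this ordered basis; it is a surjective homomorphism with kernel $\{\pm I\}$. The Lie algebra $\mathrm{spin}^{+}(4,1)$ consists of the $\Lambda=Z+Wj$ with $$Z=\begin{pmatrix} a_1+ia_2 & b \\ c & -a_1+ia_2 \end{pmatrix},\quad W=\begin{pmatrix} \alpha_1+i\alpha_2 & \beta_1+i\beta_2 \\ \gamma_1+i\gamma_2 & -\alpha_1-i\alpha_2 \end{pmatrix}$$ with all parameters $a_1,a_2,b,c,\alpha_1,\alpha_2,\beta_1,\beta_2,\gamma_1,\gamma_2$ real. The linearization $\Psi_{4,1}:\mathrm{spin}^{+}(4,1)\to so(4,1)$ of $\Phi_{4,1}$ (the matrix of $V\mapsto\Theta_{\mathbf{H}}(\Lambda)V-V\Theta_{\mathbf{H}}(\Lambda)$) is a Lie algebra isomorphism given by $$\Psi_{4,1}(\Lambda)=\begin{pmatrix} 0 & \beta_2+\gamma_2 & -b+c & \beta_1+\gamma_1 & -2a_1 \\ -\beta_2-\gamma_2 & 0 & -2\alpha_2 & 2a_2 & -\beta_2+\gamma_2 \\ b-c & 2\alpha_2 & 0 & 2\alpha_1 & b+c \\ -\beta_1-\gamma_1 & -2a_2 & -2\alpha_1 &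 0 & -\beta_1+\gamma_1 \\ -2a_1 & -\beta_2+\gamma_2 & b+c & -\beta_1+\gamma_1 & 0 \end{pmatrix}.$$ $I_{4,1}=\mathrm{diag}(1,1,1,1,-1)$; $SO^{+}(4,1)$ is the identity component of $\{X\in M(5,\mathbf{R}):X^TI_{4,1}X=I_{4,1},\det X=1\}$ and $so(4,1)=\{A\in M(5,\mathbf{R}):A^TI_{4,1}=-I_{4,1}A\}$. *)

(* Defs.v *)
From HB Require Import structures.
From mathcomp Require Import all_boot all_order all_algebra.
From mathcomp Require Import ring.
From mathcomp Require Import all_classical all_reals all_analysis.
From mathcomp Require Import complex mxtens.

Set Implicit Arguments.
Unset Strict Implicit.
Unset Printing Implicit Defensive.

Import Order.TTheory GRing.Theory Num.Theory Num.Def.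
Import numFieldNormedType.Exports.

Local Open Scope classical_set_scope.
Local Open Scope ring_scope.
Local Open Scope sesquilinear_scope.

(* Quat a b c d is the quaternion a + b i + c j + d k. *)
Record quat (R : Type) : Type := Quat { qR : R; qI : R; qJ : R; qK : R }.

Definition quat_seq (R : Type) (x : quat R) :=
  let: Quat a b c d := x in [:: a; b; c; d].
Definition seq_quat (R : Type) (s : seq R) :=
  if s is [:: a; b; c; d] then Some (Quat a b c d) else None.
Lemma quat_seqK (R : Type) : pcancel (@quat_seq R) (@seq_quat R).
Proof. by case. Qed.

HB.instance Definition _ (R : choiceType) := Choice.copy (quat R)
  (pcan_type (@quat_seqK R)).

Section QuatRing.
Variable R : comNzRingType.
Implicit Types x y z : quat R.

Definition quat_add x y :=
  Quat (qR x + qR y) (qI x + qI y) (qJ x + qJ y) (qK x + qK y).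
Definition quat_opp x := Quat (- qR x) (- qI x) (- qJ x) (- qK x).
Definition quat_zero : quat R := Quat 0 0 0 0.
Definition quat_one : quat R := Quat 1 0 0 0.
Definition quat_mul x y :=
  Quat (qR x * qR y - qI x * qI y - qJ x * qJ y - qK x * qK y)
       (qR x * qI y + qI x * qR y + qJ x * qK y - qK x * qJ y)
       (qR x * qJ y - qI x * qK y + qJ x * qR y + qK x * qI y)
       (qR x * qK y + qI x * qJ y - qJ x * qI y + qK x * qR y).

Fact quat_addA : associative quat_add.
Proof. by move=> [????] [????] [????]; congr Quat; exact: addrA. Qed.
Fact quat_addC : commutative quat_add.
Proof. by move=> [????] [????]; congr Quat; exact: addrC. Qed.
Fact quat_add0 : left_id quat_zero quat_add.
Proof. by move=> [????]; congr Quat; exact: add0r. Qed.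
Fact quat_addN : left_inverse quat_zero quat_opp quat_add.
Proof. by move=> [????]; congr Quat; exact: addNr. Qed.

HB.instance Definition _ := GRing.isZmodule.Build (quat R)
  quat_addA quat_addC quat_add0 quat_addN.

Fact quat_mulA : associative quat_mul.
Proof. by move=> [????] [????] [????]; congr Quat => /=; ring. Qed.
Fact quat_mul1l : left_id quat_one quat_mul.
Proof. by move=> [????]; congr Quat => /=; ring. Qed.
Fact quat_mul1r : right_id quat_one quat_mul.
Proof. by move=> [????]; congr Quat => /=; ring. Qed.
Fact quat_mulDl : left_distributive quat_mul +%R.
Proof. by move=> [????] [????] [????]; congr Quat => /=; ring. Qed.
Fact quat_mulDr : right_distributive quat_mul +%R.
Proof. by move=> [????] [????] [????]; congr Quat => /=; ring. Qed.
Fact quat_one_neq0 : quat_one != 0.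
Proof. by apply/eqP => -[] /eqP; rewrite oner_eq0. Qed.

HB.instance Definition _ := GRing.Zmodule_isNzRing.Build (quat R)
  quat_mulA quat_mul1l quat_mul1r quat_mulDl quat_mulDr quat_one_neq0.

Definition quat_real (a : R) : quat R := Quat a 0 0 0.
Definition quat_complex (z : R[i]) : quat R :=
  Quat (complex.Re z) (complex.Im z) 0 0.
Definition quat_i : quat R := Quat 0 1 0 0.
Definition quat_j : quat R := Quat 0 0 1 0.
Definition quat_k : quat R := Quat 0 0 0 1.

Lemma quat_ij : quat_i * quat_j = quat_k.
Proof. by congr Quat => /=; ring. Qed.

End QuatRing.

Arguments quat_i {R}.
Arguments quat_j {R}.
Arguments quat_k {R}.
Notation "a %:H" := (quat_real a) (at level 1, format "a %:H")
  : ring_scope.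

(* The matrix with the given rows, filled up with zeros. *)
Definition seqmx (R : nmodType) m n (s : seq (seq R)) : 'M[R]_(m, n) :=
  \matrix_(i, j) nth 0 (nth [::] s i) j.

Section HMatrix.
Variable R : realType.
Local Notation C := R[i].
Local Notation H := (quat R).

(* Z + W j *)
Definition HmxZW (Z W : 'M[C]_2) : 'M[H]_2 :=
  map_mx (@quat_complex R) Z + map_mx (fun w => quat_complex w * quat_j) W.

(* a + b i + c j + d k = (a + b i) + (c + d i) j *)
Definition Zmx (A : 'M[H]_2) : 'M[C]_2 :=
  map_mx (fun q => Complex (qR q) (qI q)) A.
Definition Wmx (A : 'M[H]_2) : 'M[C]_2 :=
  map_mx (fun q => Complex (qJ q) (qK q)) A.

Lemma HmxZWK (A : 'M[H]_2) : HmxZW (Zmx A) (Wmx A) = A.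
Proof.
apply/matrixP => i j; rewrite !mxE.
by case: (A i j) => a b c d; congr Quat => /=; ring.
Qed.

Lemma HmxZW_inj (Z W Z' W' : 'M[C]_2) :
  HmxZW Z W = HmxZW Z' W' -> Z = Z' /\ W = W'.
Proof.
move=> E; split; apply/matrixP => i j; move/matrixP/(_ i j): E;
  rewrite !mxE; case: (Z i j) (W i j) (Z' i j) (W' i j)
  => [a b] [c d] [a' b'] [c' d'] [] /=;
  rewrite !(mulr0, mulr1, mul0r, mul1r, addr0, add0r, subr0, oppr0).
  by move=> -> ->.
by move=> _ _ -> ->.
Qed.

Definition Theta (A : 'M[H]_2) : 'M[C]_4 :=
  block_mx (Zmx A)                  (Wmx A)
           (- map_mx conjC (Wmx A)) (map_mx conjC (Zmx A)) : 'M[C]_(2 + 2).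

Definition sigma_x : 'M[C]_2 := seqmx 2 2 [:: [:: 0; 1]; [:: 1; 0]].
Definition sigma_y : 'M[C]_2 := seqmx 2 2 [:: [:: 0; - 'i%C]; [:: 'i%C; 0]].
Definition sigma_z : 'M[C]_2 := seqmx 2 2 [:: [:: 1; 0]; [:: 0; -1]].

Definition Cl41_basis (i : 'I_5) : 'M[C]_4 :=
  [:: sigma_z *t sigma_x;
      - (sigma_y *t 1%:M);
      sigma_z *t sigma_z;
      sigma_x *t 1%:M;
      - (sigma_z *t ('i%C *: sigma_y))]`_i.

(* The real matrix, in the ordered basis V_1, ..., V_5, of a linear map f that
   preserves the real span of the V_i (a junk value if f does not). *)
Definition Cl41_matrix (f : 'M[C]_4 -> 'M[C]_4) : 'M[R]_5 :=
  xget (0 : 'M[R]_5) [set X : 'M[R]_5 | forall j,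
    f (Cl41_basis j) = \sum_i (X i j)%:C%C *: Cl41_basis i].

Definition formM : 'M[C]_4 :=
  block_mx ('i%C *: sigma_y) 0 0 (- ('i%C *: sigma_y)) : 'M[C]_(2 + 2).

Definition Spin41 : set 'M[H]_2 :=
  [set Y | (Theta Y)^t* *m formM *m Theta Y = formM].

Definition Phi41 (Y : 'M[H]_2) : 'M[R]_5 :=
  Cl41_matrix (fun v => Theta Y *m v *m invmx (Theta Y)).

Record spin41_param := Spin41Param {
  sp_a1 : R; sp_a2 : R; sp_b : R; sp_c : R;
  sp_alpha1 : R; sp_alpha2 : R;
  sp_beta1 : R; sp_beta2 : R; sp_gamma1 : R; sp_gamma2 : R }.

Definition spin41_elt (s : spin41_param) : 'M[H]_2 :=
  HmxZW
    (seqmx 2 2 [:: [:: (sp_a1 s +i* sp_a2 s)%C; (sp_b s)%:C%C];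
                   [:: (sp_c s)%:C%C; ((- sp_a1 s) +i* sp_a2 s)%C]])
    (seqmx 2 2 [:: [:: (sp_alpha1 s +i* sp_alpha2 s)%C; (sp_beta1 s +i* sp_beta2 s)%C];
                   [:: (sp_gamma1 s +i* sp_gamma2 s)%C;
                       ((- sp_alpha1 s) +i* (- sp_alpha2 s))%C]]).

Definition spin41 : set 'M[H]_2 := range spin41_elt.

Definition Psi41 (L : 'M[H]_2) : 'M[R]_5 :=
  Cl41_matrix (fun v => Theta L *m v - v *m Theta L).

Definition I41 : 'M[R]_5 := diag_mx (\row_i [:: 1; 1; 1; 1; -1]`_i).

Definition SOplus41 : set 'M[R]_5 :=
  connected_component [set X : 'M[R]_5 | X^T *m I41 *m X = I41 /\ \det X = 1]
    1%:M.

Definition so41 : set 'M[R]_5 := [set A | A^T *m I41 = - (I41 *m A)].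

Definition special_orthogonal n : set 'M[R]_n :=
  [set V | V^T *m V = 1%:M /\ \det V = 1].

Definition positive_definite n : set 'M[R]_n :=
  [set P | P^T = P /\ forall x : 'cV[R]_n, x != 0 -> 0 < (x^T *m P *m x) 0 0].

Definition expmx n (A : 'M[R]_n.+1) : 'M[R]_n.+1 :=
  limn (series (fun k => k`!%:R^-1 *: A ^+ k)).

Definition cosh (x : R) : R := (expR x + expR (- x)) / 2.
Definition sinh (x : R) : R := (expR x - expR (- x)) / 2.

(* sinh x / x, sin x / x and (1 - cos x) / x^2, extended by their limits at 0 *)
Definition sinhc (x : R) : R := if x == 0 then 1 else sinh x / x.
Definition sinc (x : R) : R := if x == 0 then 1 else sin x / x.
Definition cosc2 (x : R) : R := if x == 0 then 2^-1 else (1 - cos x) / x ^+ 2.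

Definition Y1mx (p1 p2 p3 : R) : 'M[R]_4 := seqmx 4 4
  [:: [:: 0;   - p1; - p2; - p3];
      [:: p1;  0;    - p3; p2];
      [:: p2;  p3;   0;    - p1];
      [:: p3;  - p2; p1;   0]].

Definition Y2mx (q1 q2 q3 : R) : 'M[R]_4 := seqmx 4 4
  [:: [:: 0;    q1;   q2;   q3];
      [:: - q1; 0;    - q3; q2];
      [:: - q2; q3;   0;    - q1];
      [:: - q3; - q2; q1;   0]].

(* Y (+) 0_{1x1} *)
Definition pad0 (Y : 'M[R]_4) : 'M[R]_5 :=
  block_mx Y 0 0 (0 : 'M[R]_1) : 'M[R]_(4 + 1).

Definition kappa (s : spin41_param) : R :=
  2 * Num.sqrt (sp_a2 s ^+ 2 + sp_alpha1 s ^+ 2 + sp_alpha2 s ^+ 2).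

(* I_2 + (sin k / k) A + ((1 - cos k) / k^2) A^2 *)
Definition rodrigues (k : R) (A : 'M[H]_2) : 'M[H]_2 :=
  1%:M + (sinc k)%:H *: A + (cosc2 k)%:H *: A ^+ 2.

End HMatrix.

(* Main.v *)
(* Multiplying the one-vectors V_j by i puts them, like the invariant form M = - V_5, in the
   image of Theta, so every identity between them can be checked in M(2,H).
   Write P = Exp(2 l N) and V = Exp(x J1 + y J2) with unit directions: then N^3 = N, while J1 and
   J2 are commuting isoclinic rotations, so both exponentials are explicit quadratic
   polynomials.  Upstairs the unit elements satisfy L^2 = 1 and K^3 = - K, and a computation
   in an associative algebra, using only ad_L or ad_K on the V_j, shows that conjugation by
   cosh l + sinh l L and by 1 + sin x K + (1 - cos x) K^2 is the corresponding exponential.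
   The fibre of Phi is {B, - B}: two elements over the same matrix differ by an
   element of M(2,H) commuting with all V_j, i.e. a real scalar, and M forces its square to be 1. *)

Require Import Defs.
From mathcomp Require Import all_boot all_order all_algebra.
From mathcomp Require Import all_classical all_reals all_analysis.
From mathcomp Require Import complex mxtens ring lra.
Import Order.TTheory GRing.Theory Num.Theory Num.Def.
Import numFieldNormedType.Exports.

Set Implicit Arguments.
Unset Strict Implicit.
Unset Printing Implicit Defensive.

Local Open Scope classical_set_scope.
Local Open Scope ring_scope.

(** * Entries and indices of small matrices *)

Lemma ord2P (P : 'I_2 -> Prop) : P ord0 -> P (lift ord0 ord0) -> forall i, P i.
Proof.
move=> P0 P1 [[|[|//]] Hi]; [have -> : Ordinal Hi = ord0 by exact: val_inj|
  have -> : Ordinal Hi = lift ord0 ord0 by exact: val_inj]; by [].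
Qed.

Lemma seqmx2E (T : nmodType) (s : seq (seq T)) :
  ((seqmx 2 2 s ord0 ord0 = nth 0 (nth [::] s 0) 0) *
   (seqmx 2 2 s ord0 (lift ord0 ord0) = nth 0 (nth [::] s 0) 1) *
   (seqmx 2 2 s (lift ord0 ord0) ord0 = nth 0 (nth [::] s 1) 0) *
   (seqmx 2 2 s (lift ord0 ord0) (lift ord0 ord0) = nth 0 (nth [::] s 1) 1))%type.
Proof. by rewrite !mxE. Qed.

Lemma mulmx2E (T : pzSemiRingType) (A B : 'M[T]_2) i l :
  (A *m B) i l = A i ord0 * B ord0 l + A i (lift ord0 ord0) * B (lift ord0 ord0) l.
Proof. by rewrite mxE !big_ord_recl big_ord0 addr0. Qed.

(** [mxtens_index] orders pairs lexicographically, so the index of the left factor selects the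
    block. *)
Lemma tensmx2E (T : pzRingType) (A B : 'M[T]_2) :
  A *t B = block_mx (A ord0 ord0 *: B) (A ord0 (lift ord0 ord0) *: B)
    (A (lift ord0 ord0) ord0 *: B)
    (A (lift ord0 ord0) (lift ord0 ord0) *: B) :> 'M[T]_(2 + 2).
Proof.
have o0 (k : 'I_2) : lshift 2 k = mxtens_index (ord0 : 'I_2, k).
  by apply: val_inj.
have o1 (k : 'I_2) : rshift 2 k = mxtens_index (lift ord0 ord0 : 'I_2, k).
  by apply: val_inj.
rewrite -[LHS](@submxK _ 2 2 2 2).
by congr block_mx; apply/matrixP => i j;
  rewrite [LHS]mxE [LHS]mxE [RHS]mxE ?o0 ?o1; exact: (tensmxE A B _ i _ j).
Qed.

Local Notation o5 k := (@Ordinal 5 k isT).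

Lemma sum5 (V : nmodType) (F : 'I_5 -> V) :
  \sum_i F i = F (o5 0) + F (o5 1) + F (o5 2) + F (o5 3) + F (o5 4).
Proof.
rewrite !big_ord_recl big_ord0 addr0 !addrA.
by congr (_ + _ + _ + _ + _); congr F; apply: val_inj.
Qed.

Lemma quatP (T : Type) (x y : quat T) :
  qR x = qR y -> qI x = qI y -> qJ x = qJ y -> qK x = qK y -> x = y.
Proof. by case: x y => [????] [????] /= -> -> -> ->. Qed.

Local Open Scope sesquilinear_scope.

(** * The embedding of quaternionic matrices *)

Section Theta.
Variable R : realType.
Local Notation C := R[i].
Local Notation H := (quat R).
Implicit Types (A B Y : 'M[H]_2) (r : R) (s : spin41_param R) (X P : 'M[R]_5).

Lemma Zmx_mul A B :
  Zmx (A *m B) = Zmx A *m Zmx B - Wmx A *m map_mx conjC (Wmx B).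
Proof.
apply/matrixP => i j; rewrite !mxE !big_ord_recl !big_ord0 !mxE.
by apply/eqP; rewrite eq_complex /=; apply/andP; split; apply/eqP; ring.
Qed.

Lemma Wmx_mul A B :
  Wmx (A *m B) = Zmx A *m Wmx B + Wmx A *m map_mx conjC (Zmx B).
Proof.
apply/matrixP => i j; rewrite !mxE !big_ord_recl !big_ord0 !mxE.
by apply/eqP; rewrite eq_complex /=; apply/andP; split; apply/eqP; ring.
Qed.

Lemma ThetaM A B : Theta (A *m B) = Theta A *m Theta B.
Proof.
rewrite /Theta Zmx_mul Wmx_mul (@mulmx_block _ 2 2 2 2 2 2).
apply: (f_equal4 (@block_mx C 2 2 2 2)).
- by rewrite mulmxN.
- by [].
- rewrite !mulNmx map_mxD !map_mxM /= -map_mx_comp.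
  have -> : map_mx (conjC \o conjC) (Zmx B) = Zmx B.
    by apply/matrixP => i j; rewrite !mxE /= conjCK.
  by rewrite opprD mulmxN; exact: addrC.
- rewrite mulNmx map_mxB !map_mxM /= -map_mx_comp addrC.
  suff -> : map_mx (conjC \o conjC) (Wmx B) = Wmx B by [].
  by apply/matrixP => i j; rewrite !mxE /= conjCK.
Qed.

Lemma ThetaD A B : Theta (A + B) = Theta A + Theta B.
Proof.
rewrite /Theta (@add_block_mx _ 2 2 2 2); apply: (f_equal4 (@block_mx C 2 2 2 2)).
- by apply/matrixP => i j; rewrite !mxE.
- by apply/matrixP => i j; rewrite !mxE.
- by apply/matrixP => i j; rewrite !mxE; apply/eqP; rewrite eq_complex /= !opprD !eqxx.
- by apply/matrixP => i j; rewrite !mxE; apply/eqP; rewrite eq_complex /= !opprD !eqxx.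
Qed.

Lemma ThetaZ r A : Theta (r%:H *: A) = r%:C%C *: Theta A.
Proof.
rewrite /Theta (@scale_block_mx _ 2 2 2 2); apply: (f_equal4 (@block_mx C 2 2 2 2));
by apply/matrixP => i j; rewrite !mxE; apply/eqP; rewrite eq_complex /=;
 apply/andP; split; apply/eqP; ring.
Qed.

Lemma Theta1 : Theta (1%:M : 'M[H]_2) = 1%:M.
Proof.
rewrite (@scalar_mx_block _ 2 2) /Theta; apply: (f_equal4 (@block_mx C 2 2 2 2));
by apply/matrixP; apply: ord2P; apply: ord2P; rewrite !mxE;
 apply/eqP; rewrite eq_complex /= ?oppr0 !eqxx.
Qed.

Lemma Theta0 : Theta (0 : 'M[H]_2) = 0.
Proof. by apply: (addIr (Theta 0)); rewrite -ThetaD !add0r. Qed.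

Lemma ThetaN A : Theta (- A) = - Theta A.
Proof. by apply: (addIr (Theta A)); rewrite -ThetaD !addNr Theta0. Qed.

Lemma Theta_inj : injective (@Theta R).
Proof.
move=> A B /(@eq_block_mx _ 2 2 2 2)[EZ EW _ _].
by rewrite -[A]HmxZWK -[B]HmxZWK EZ EW.
Qed.

(* ['i V_i] rather than [V_i] is the image of a quaternionic matrix. *)
Definition vH (i : 'I_5) : 'M[H]_2 :=
 [:: seqmx 2 2 [:: [:: 0; quat_i]; [:: quat_i; 0]];
     seqmx 2 2 [:: [:: - quat_j; 0]; [:: 0; - quat_j]];
     seqmx 2 2 [:: [:: quat_i; 0]; [:: 0; - quat_i]];
     seqmx 2 2 [:: [:: quat_k; 0]; [:: 0; quat_k]];
     seqmx 2 2 [:: [:: 0; - quat_i]; [:: quat_i; 0]] ]`_i.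

Lemma ThetavH i : Theta (vH i) = 'i%C *: Cl41_basis R i.
Proof.
rewrite /vH /Cl41_basis /sigma_x /sigma_y /sigma_z.
case: i => [[|[|[|[|[|//]]]]] Hi] /=; rewrite ?tensmx2E !seqmx2E /=
  ?(@opp_block_mx _ 2 2 2 2) (@scale_block_mx _ 2 2 2 2) /Theta;
apply: (f_equal4 (@block_mx C 2 2 2 2));
by apply/matrixP; apply: ord2P; apply: ord2P; rewrite !mxE /=;
 apply/eqP; rewrite eq_complex /=;
 apply/andP; split; apply/eqP; ring.
Qed.

(** As $M=-V_5=i\,(iV_5)$, invariance of $M$ can be tested in $M(2,\mathbf H)$. *)
Lemma formM_vH : formM R = 'i%C *: Theta (vH (o5 4)).
Proof.
have -> : formM R = - Cl41_basis R (o5 4).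
  rewrite /Cl41_basis /= opprK tensmx2E !seqmx2E /= /formM /sigma_y.
  apply: (f_equal4 (@block_mx C 2 2 2 2));
  by apply/matrixP; apply: ord2P; apply: ord2P; rewrite !mxE /=;
   apply/eqP; rewrite eq_complex /=;
   apply/andP; split; apply/eqP; ring.
rewrite ThetavH scalerA (_ : 'i%C * 'i%C = -1) ?scaleN1r //.
by apply/eqP; rewrite eq_complex /=; apply/andP; split; apply/eqP; ring.
Qed.

(** * The Lie algebra acting on one-vectors by brackets *)

Lemma spin41_eltE s : spin41_elt s = seqmx 2 2
  [:: [:: Quat (sp_a1 s) (sp_a2 s) (sp_alpha1 s) (sp_alpha2 s);
          Quat (sp_b s) 0 (sp_beta1 s) (sp_beta2 s)];
      [:: Quat (sp_c s) 0 (sp_gamma1 s) (sp_gamma2 s);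
          Quat (- sp_a1 s) (sp_a2 s) (- sp_alpha1 s) (- sp_alpha2 s)]].
Proof.
apply/matrixP; apply: ord2P; apply: ord2P; rewrite !mxE /=;
congr Quat => /=; ring.
Qed.

(** [Psi41] is defined through a choice of matrix; this is the closed formula with which
    [Psi41_spin41] identifies it. *)
Definition Psi_mx s : 'M[R]_5 :=
  let: Spin41Param a1 a2 b c al1 al2 be1 be2 ga1 ga2 := s in
  seqmx 5 5
  [:: [:: 0; be2 + ga2; - b + c; be1 + ga1; - (2 * a1)];
      [:: - be2 - ga2; 0; - (2 * al2); 2 * a2; - be2 + ga2];
      [:: b - c; 2 * al2; 0; 2 * al1; b + c];
      [:: - be1 - ga1; - (2 * a2); - (2 * al1); 0; - be1 + ga1];
      [:: - (2 * a1); - be2 + ga2; b + c; - be1 + ga1; 0]].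

Definition vH_comb (X : 'M[R]_5) j := \sum_i (X i j)%:H *: vH i.

Lemma vH_combE (X : 'M[R]_5) j : vH_comb X j =
  let x0 := X (o5 0) j in let x1 := X (o5 1) j in let x2 := X (o5 2) j in
  let x3 := X (o5 3) j in let x4 := X (o5 4) j in
  seqmx 2 2
   [:: [:: Quat 0 x2 (- x1) x3; Quat 0 (x0 - x4) 0 0];
       [:: Quat 0 (x0 + x4) 0 0; Quat 0 (- x2) (- x1) x3]].
Proof.
rewrite /=; apply/matrixP => k l; rewrite summxE sum5 /vH /= !mxE.
by move: k l; apply: ord2P; apply: ord2P; apply: quatP => /=; ring.
Qed.

Lemma ad_spin41 s j :
  spin41_elt s *m vH j - vH j *m spin41_elt s = vH_comb (Psi_mx s) j.
Proof.
rewrite spin41_eltE vH_combE; case: s => a1 a2 b c al1 al2 be1 be2 ga1 ga2.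
case: j => [[|[|[|[|[|//]]]]] Hj];
apply/matrixP; apply: ord2P; apply: ord2P;
rewrite /vH !mxE /= !big_ord_recl !big_ord0 !mxE /=;
apply: quatP => /=; ring.
Qed.

Definition quat_conj (x : H) : H := Quat (qR x) (- qI x) (- qJ x) (- qK x).
Definition dagger A : 'M[H]_2 := (map_mx quat_conj A)^T.

Lemma Theta_dagger A : Theta (dagger A) = (Theta A)^t*.
Proof.
rewrite /Theta (@tr_block_mx _ 2 2 2 2) (@map_block_mx _ _ _ 2 2 2 2);
apply: (f_equal4 (@block_mx C 2 2 2 2));
by apply/matrixP => i j; rewrite !mxE /=; apply/eqP; rewrite eq_complex /= ?opprK !eqxx.
Qed.

Lemma daggerZ r A : dagger (r%:H *: A) = r%:H *: dagger A.
Proof.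
by apply/matrixP => i j; rewrite !mxE; apply: quatP => /=; ring.
Qed.

Definition Cl41_comb X j := \sum_i (X i j)%:C%C *: Cl41_basis R i.

Lemma Theta_vH_comb X j : Theta (vH_comb X j) = 'i%C *: Cl41_comb X j.
Proof.
rewrite /vH_comb /Cl41_comb scaler_sumr.
rewrite (big_morph _ ThetaD Theta0); apply: eq_bigr => i _.
by rewrite ThetaZ ThetavH !scalerA mulrC.
Qed.

Lemma complex_i_neq0 : 'i%C != 0 :> C.
Proof. by rewrite eq_complex /= oner_eq0 andbF. Qed.

(** By [vH_combE] the first diagonal entry carries the second, third and fourth coordinates of a
    column, and the off-diagonal entries carry the difference and the sum of the first and fifth. *)
Lemma vH_comb_inj X X' : (forall j, vH_comb X j = vH_comb X' j) -> X = X'.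
Proof.
move=> E; apply/matrixP => i j; move: (E j); rewrite !vH_combE => /matrixP Ej.
move: (Ej ord0 ord0) (Ej ord0 (lift ord0 ord0)) (Ej (lift ord0 ord0) ord0).
rewrite !mxE /= => -[] e2 e1 e3 [] e4 [] e5.
by case: i => [[|[|[|[|[|//]]]]] Hi];
 [ have -> : Ordinal Hi = o5 0 by exact: val_inj
 | have -> : Ordinal Hi = o5 1 by exact: val_inj
 | have -> : Ordinal Hi = o5 2 by exact: val_inj
 | have -> : Ordinal Hi = o5 3 by exact: val_inj
 | have -> : Ordinal Hi = o5 4 by exact: val_inj ]; lra.
Qed.

Lemma Cl41_comb_inj X X' : (forall j, Cl41_comb X j = Cl41_comb X' j) -> X = X'.
Proof.
move=> E; apply: vH_comb_inj => j; apply: Theta_inj.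
by rewrite !Theta_vH_comb E.
Qed.

(** Linear independence of the $V_i$ leaves a single candidate for the [xget] in [Cl41_matrix]. *)
Lemma Cl41_matrixE (f : 'M[C]_4 -> 'M[C]_4) X :
  (forall j, f (Cl41_basis R j) = Cl41_comb X j) -> Cl41_matrix f = X.
Proof.
move=> fX; apply: xget_unique => // X' fX'; apply: Cl41_comb_inj => j.
by rewrite -fX [RHS]fX'.
Qed.

Lemma ad_spin41_basis s j :
  Theta (spin41_elt s) *m Cl41_basis R j -
  Cl41_basis R j *m Theta (spin41_elt s) = Cl41_comb (Psi_mx s) j.
Proof.
apply: (scalerI complex_i_neq0); rewrite -Theta_vH_comb -ad_spin41 scalerBr.
rewrite scalemxAr scalemxAl -ThetavH -!ThetaM.
by rewrite ThetaD ThetaN.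
Qed.

Lemma Psi41_spin41 s : Psi41 (spin41_elt s) = Psi_mx s.
Proof. by apply: Cl41_matrixE => j; exact: ad_spin41_basis. Qed.

Lemma Psi_mx_inj : injective Psi_mx.
Proof.
case=> [a1 a2 b c al1 al2 be1 be2 ga1 ga2] [a1' a2' b' c' al1' al2' be1' be2' ga1' ga2'].
move/matrixP => E.
move: (E (o5 0) (o5 1)) (E (o5 0) (o5 2)) (E (o5 0) (o5 3)) (E (o5 0) (o5 4))
  (E (o5 1) (o5 2)) (E (o5 1) (o5 3)) (E (o5 1) (o5 4))
  (E (o5 2) (o5 3)) (E (o5 2) (o5 4)) (E (o5 3) (o5 4)).
by rewrite !mxE /= => *; congr Spin41Param; lra.
Qed.

Lemma Psi41_fiber s : @spin41 R `&` @Psi41 R @^-1` [set Psi_mx s] = [set spin41_elt s].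
Proof.
apply/seteqP; split => [A [[s' _ <-]] /=|_ ->].
  by rewrite Psi41_spin41 => /Psi_mx_inj ->.
by split; [exists s | rewrite /= Psi41_spin41].
Qed.

(** * The commutant of the one-vectors and the fibres of $\Phi_{4,1}$ *)

Lemma quat_commutant_jk (x : H) :
  x * quat_j = quat_j * x -> x * quat_k = quat_k * x -> x = (qR x)%:H.
Proof.
case: x => a b c d [] ? ? ? ? [] ? ? ? ?.
by apply: quatP => /=; lra.
Qed.

(** $iV_2$ and $iV_4$ are the scalar matrices $-j$ and $k$, so each entry of [A] commutes with $j$
    and $k$ and is real. Then $iV_3$ kills the off-diagonal entries and $iV_1$ equates the diagonal
    ones. *)
Lemma vH_commutant A :
  (forall j, A *m vH j = vH j *m A) -> exists r, A = r%:H%:M.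
Proof.
move=> E.
have scalE (q : H) k : vH k = q%:M -> forall i l, A i l * q = q * A i l.
  move=> Ek i l; have /matrixP/(_ i l) := E k.
  rewrite Ek mul_scalar_mx [RHS]mxE => <-.
  rewrite mxE (bigD1 l) //= big1 ?addr0 => [|k' /negPf k'l]; rewrite !mxE ?eqxx //.
  by rewrite k'l mulr0.
have v1 : vH (o5 1) = (- quat_j)%:M.
  by apply/matrixP; apply: ord2P; apply: ord2P; rewrite !mxE.
have v3 : vH (o5 3) = quat_k%:M.
  by apply/matrixP; apply: ord2P; apply: ord2P; rewrite !mxE.
have AR i l : A i l = (qR (A i l))%:H.
  apply: quat_commutant_jk; last exact: scalE v3 i l.
  by apply: oppr_inj; rewrite -mulrN -mulNr; exact: scalE v1 i l.
have /matrixP/(_ ord0 (lift ord0 ord0)) := E (o5 2).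
have /matrixP/(_ (lift ord0 ord0) ord0) := E (o5 2).
have /matrixP/(_ (lift ord0 ord0) ord0) := E (o5 0).
rewrite !mulmx2E.
have [v000 v010 v011] : [/\ vH (o5 0) ord0 ord0 = 0,
  vH (o5 0) (lift ord0 ord0) ord0 = quat_i &
  vH (o5 0) (lift ord0 ord0) (lift ord0 ord0) = 0] by rewrite !mxE.
have [v200 v201 v210 v211] : [/\ vH (o5 2) ord0 ord0 = quat_i,
  vH (o5 2) ord0 (lift ord0 ord0) = 0,
  vH (o5 2) (lift ord0 ord0) ord0 = 0 &
  vH (o5 2) (lift ord0 ord0) (lift ord0 ord0) = - quat_i] by rewrite !mxE.
rewrite v000 v010 v011 v200 v201 v210 v211.
rewrite (AR ord0 ord0) (AR ord0 (lift ord0 ord0)) (AR (lift ord0 ord0) ord0)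
  (AR (lift ord0 ord0) (lift ord0 ord0)).
move=> [] _ e1 _ _ [] _ e2 _ _ [] _ e3 _ _.
exists (qR (A ord0 ord0)); apply/matrixP; apply: ord2P; apply: ord2P;
 rewrite AR !mxE //=; congr _%:H; rewrite /= in e1 e2 e3 *; lra.
Qed.

Lemma Theta_mul1 (A B : 'M[H]_2) : Theta A *m Theta B = 1%:M -> A *m B = 1%:M.
Proof. by rewrite -ThetaM -Theta1 => /Theta_inj. Qed.

Lemma Spin41E B : Spin41 B <-> dagger B *m vH (o5 4) *m B = vH (o5 4).
Proof.
have -> : Spin41 B = ((Theta B)^t* *m formM R *m Theta B = formM R) by [].
rewrite formM_vH -Theta_dagger -scalemxAr -scalemxAl -!ThetaM.
by split => [/(scalerI complex_i_neq0)/Theta_inj|->].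
Qed.

(** Since $(iV_5)^2=I$, the form relation itself exhibits a left inverse. It is two-sided because
    its image under [Theta] has entries in the commutative field $\mathbf C$. *)
Lemma Spin41_inv B : Spin41 B -> exists B', B' *m B = 1%:M /\ B *m B' = 1%:M.
Proof.
move=> /Spin41E E; exists (vH (o5 4) *m dagger B *m vH (o5 4)).
have B'B : vH (o5 4) *m dagger B *m vH (o5 4) *m B = 1%:M.
  rewrite -!mulmxA [dagger B *m _]mulmxA E.
  apply/matrixP; apply: ord2P; apply: ord2P;
  rewrite /vH !mxE /= !big_ord_recl !big_ord0 !mxE /=;
  apply: quatP => /=; ring.
by split=> //; apply: Theta_mul1; apply: mulmx1C; rewrite -ThetaM B'B Theta1.
Qed.

(** The last hypothesis is conjugation with the inverse cleared; [P != 0] separates [P] from the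
    default value of [Cl41_matrix]. *)
Lemma Phi41_fiber B P : Spin41 B -> P != 0 ->
  (forall j, Theta B *m Cl41_basis R j = Cl41_comb P j *m Theta B) ->
  @Spin41 R `&` @Phi41 R @^-1` [set P] = [set B; - B].
Proof.
move=> SB P0 E.
have Phi A : Spin41 A ->
    (forall j, Theta A *m Cl41_basis R j = Cl41_comb P j *m Theta A) ->
    Phi41 A = P.
  move=> /Spin41_inv[A' [A'A AA']] EA; apply: Cl41_matrixE => j.
  rewrite EA -mulmxA mulmxV ?mulmx1 //.
  have : Theta A *m Theta A' = 1%:M by rewrite -ThetaM AA' Theta1.
  by move/mulmx1_unit => [].
apply/seteqP; split => [Y [SY /= PhiY]|A].
- have [B' [B'B BB']] := Spin41_inv SB.
  have [Y' [Y'Y YY']] := Spin41_inv SY.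
  have ThY : Theta Y \in unitmx.
    have : Theta Y *m Theta Y' = 1%:M by rewrite -ThetaM YY' Theta1.
    by move/mulmx1_unit => [].
  have EY j : Theta Y *m Cl41_basis R j = Cl41_comb P j *m Theta Y.
    (* If no matrix represented the conjugation by [Y], [xget] would return $0$. *)
    move: PhiY; rewrite /Phi41 /Cl41_matrix; case: xgetP => [X -> HX XP|_ PE].
      by rewrite XP in HX; rewrite /Cl41_comb -(HX j) mulmxKV.
    by rewrite -PE eqxx in P0.
  (* Both [Y] and [B] induce [P], so conjugation by their quotient fixes every one-vector. *)
  have [r Er] : exists r, B' *m Y = r%:H%:M.
    apply: vH_commutant => j; apply: Theta_inj.
    rewrite !ThetaM ThetavH -scalemxAr -scalemxAl; congr (_ *: _).
    rewrite -mulmxA EY.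
    have -> : Cl41_comb P j = Theta B *m Cl41_basis R j *m Theta B'.
      by rewrite E -mulmxA -ThetaM BB' Theta1 mulmx1.
    by rewrite !mulmxA -ThetaM B'B Theta1 mul1mx.
  have EYB : Y = r%:H *: B.
    apply: Theta_inj; rewrite ThetaZ.
    by rewrite -[Y]mul1mx -BB' -mulmxA Er -scalemx1 ThetaM ThetaZ Theta1 -scalemxAr mulmx1.
  (* Invariance of $M$ under $Y=rB$ scales $iV_5$ by $r^2$; one nonzero entry decides. *)
  have : r ^+ 2 = 1.
    move/Spin41E: SY; rewrite EYB daggerZ => /(congr1 (@Theta R)).
    rewrite !ThetaM !ThetaZ -!scalemxAl -scalemxAr -!ThetaM.
    move/Spin41E: (SB) => ->; rewrite -!ThetaZ => /Theta_inj/matrixP/(_ ord0 (lift ord0 ord0)).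
    rewrite !mxE /= => -[] _ ? _ _; lra.
  move/eqP; rewrite sqrf_eq1 => /orP[] /eqP r1; [left|right]; rewrite /= EYB r1.
    by apply: Theta_inj; rewrite ThetaZ scale1r.
  by apply: Theta_inj; rewrite ThetaZ ThetaN rmorphN1 scaleN1r.
- case=> ->; first by split => //; exact: Phi.
  have SN : Spin41 (- B).
    move/Spin41E: (SB) => SB'; apply/Spin41E.
    have -> : dagger (- B) = - dagger B.
      by apply/matrixP => i j; rewrite !mxE; apply: quatP => /=; rewrite ?oppr0.
    by rewrite mulmxN !mulNmx opprK.
  by split => //=; apply: Phi => // j; rewrite ThetaN mulNmx mulmxN E.
Qed.

End Theta.

(** * Exponentials *)

Section Exponential.
Variables (R : realType) (n : nat).
Implicit Types A N L : 'M[R]_n.+1.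

(** Convergence is carried along with the value, since the [limn] in [expmx] is meaningful only for
    a convergent series. *)
Definition exp_cvg A L := series (fun k => k`!%:R^-1 *: A ^+ k) @ \oo --> L.

Lemma expmxE A L : exp_cvg A L -> expmx A = L.
Proof. by move/(@cvg_lim _ (@norm_hausdorff _ _)); apply. Qed.

Lemma cvg_series_exp_coeff (x : R) : series (exp_coeff x) @ \oo --> expR x.
Proof. exact: is_cvg_series_exp_coeff. Qed.

Lemma cvg_series_sin_coeff (x : R) : series (sin_coeff x) @ \oo --> sin x.
Proof. rewrite unlock; exact: is_cvg_series_sin_coeff. Qed.

Lemma cvg_series_cos_coeff (x : R) : series (cos_coeff x) @ \oo --> cos x.
Proof. rewrite unlock; exact: is_cvg_series_cos_coeff. Qed.

(** Powers that stay in the span of three fixed matrices reduce the matrix series to three scalar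
    ones. *)
Lemma exp_cvg_comb A (u v w : R ^nat) (a b c : R) (E F G : 'M[R]_n.+1) :
  (forall k, k`!%:R^-1 *: A ^+ k = u k *: E + v k *: F + w k *: G) ->
  series u @ \oo --> a -> series v @ \oo --> b -> series w @ \oo --> c ->
  exp_cvg A (a *: E + b *: F + c *: G).
Proof.
move=> Ak ua vb wc; rewrite /exp_cvg.
have -> : series (fun k => k`!%:R^-1 *: A ^+ k) =
    fun m => series u m *: E + series v m *: F + series w m *: G.
  apply/funext => m; rewrite /series /= !scaler_suml -!big_split /=.
  by apply: eq_bigr => k _; rewrite Ak.
apply: cvgD; [apply: cvgD|]; exact: cvgZr_tmp.
Qed.

(** This series supplies the part of an exponential that lives in the zeroth term only. *)
Lemma exp_coeff0 k : exp_coeff (0 : R) k = (k == 0)%:R.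
Proof. by rewrite /exp_coeff /= expr0n; case: k => [|k]; rewrite ?divr1 ?mul0r. Qed.

(** $\frac12(N^2+N)$, $\frac12(N^2-N)$ and $1-N^2$ are the spectral projections of $N$ for the
    eigenvalues $1,-1,0$. *)
Lemma exp_cvg_sinh x N : N ^+ 3 = N ->
  exp_cvg (x *: N) (1 + sinh x *: N + (cosh x - 1) *: N ^+ 2).
Proof.
move=> N3.
have Nk k : N ^+ k.+1 = if odd k then N ^+ 2 else N.
  by elim: k => //= k IH; rewrite exprSr IH; case: (odd k); rewrite /= -?exprSr ?N3.
have -> : 1 + sinh x *: N + (cosh x - 1) *: N ^+ 2 =
  expR x *: (2^-1 *: (N ^+ 2 + N)) + expR (- x) *: (2^-1 *: (N ^+ 2 - N)) +
  expR 0 *: (1 - N ^+ 2).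
  rewrite expR0 /sinh /cosh; move: (N ^+ 2) (1 : 'M[R]_n.+1) => S I.
  by apply/matrixP => i j; rewrite !mxE; field.
apply: (@exp_cvg_comb _ (exp_coeff x) (exp_coeff (- x)) (exp_coeff 0));
  try exact: cvg_series_exp_coeff.
move=> k.
rewrite exp_coeff0 /exp_coeff /= exprZn; case: k => [|k] /=.
  rewrite !expr0 fact0 divr1 invr1.
  move: (N ^+ 2) (1 : 'M[R]_n.+1) => S I.
  by apply/matrixP => i j; rewrite !mxE; field.
rewrite scale0r addr0 [N ^+ k.+1]Nk (_ : (- x) ^+ k.+1 = (if odd k then 1 else -1) * x ^+ k.+1).
  move: (N ^+ 2) => S; apply/matrixP => i j; case: (odd k); rewrite !mxE /=; field;
  by rewrite pnatr_eq0 -lt0n fact_gt0.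
by rewrite exprNn -signr_odd /=; case: (odd k); rewrite /= ?expr1 ?expr0.
Qed.

(** Rodrigues' formula: the positive powers run through $N,N^2,-N,-N^2$, so $N$, $-N^2$ and $1+N^2$
    carry the sine, cosine and constant series. *)
Lemma exp_cvg_sin x N : N ^+ 3 = - N ->
  exp_cvg (x *: N) (1 + sin x *: N + (1 - cos x) *: N ^+ 2).
Proof.
move=> N3.
(* The exponent is $k+1$, so odd $k$ gives an even power. *)
have Nk k : N ^+ k.+1 = (-1) ^+ k./2 *: if odd k then N ^+ 2 else N.
  elim: k => [|k IH]; first by rewrite expr0 scale1r.
  rewrite exprSr IH /= uphalf_half; case: (odd k) => /=; rewrite -scalerAl -?exprSr.
    by rewrite N3 add1n exprS mulN1r scaleNr scalerN.
  by rewrite add0n.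
have -> : 1 + sin x *: N + (1 - cos x) *: N ^+ 2 =
  sin x *: N + cos x *: (- N ^+ 2) + expR 0 *: (1 + N ^+ 2).
  rewrite expR0; move: (N ^+ 2) (1 : 'M[R]_n.+1) => S I.
  by apply/matrixP => i j; rewrite !mxE; field.
apply: (@exp_cvg_comb _ (sin_coeff x) (cos_coeff x) (exp_coeff 0));
  [move=> k|exact: cvg_series_sin_coeff|exact: cvg_series_cos_coeff|exact: cvg_series_exp_coeff].
rewrite exp_coeff0 /sin_coeff /cos_coeff /= exprZn; case: k => [|k] /=.
  rewrite !expr0 fact0 divr1 invr1.
  move: (N ^+ 2) (1 : 'M[R]_n.+1) => S I.
  by apply/matrixP => i j; rewrite !mxE; field.
rewrite scale0r addr0 [N ^+ k.+1]Nk uphalf_half negbK; case: (odd k) => /=;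
rewrite ?add1n ?add0n -?exprnP ?[(-1) ^+ k./2.+1]exprS;
move: (N ^+ 2) ((-1) ^+ k./2 : R) (x ^+ k.+1) => S e y;
apply/matrixP => i j; rewrite !mxE; field;
 by rewrite pnatr_eq0 -lt0n fact_gt0.
Qed.

(** Mixed products vanish, hence positive powers add; the final $-1$ corrects the identity being
    counted twice in the zeroth term. *)
Lemma exp_cvg_orth A B L L' : A * B = 0 -> B * A = 0 ->
  exp_cvg A L -> exp_cvg B L' -> exp_cvg (A + B) (L + L' - 1).
Proof.
move=> AB BA AL BL.
have E k : (A + B) ^+ k.+1 = A ^+ k.+1 + B ^+ k.+1.
  elim: k => [//|k IH]; rewrite exprSr IH mulrDl !mulrDr -!exprSr.
  by rewrite [A ^+ k.+1]exprSr [B ^+ k.+1]exprSr -!mulrA AB BA !mulr0 addr0 add0r.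
rewrite /exp_cvg.
have -> : series (fun k => k`!%:R^-1 *: (A + B) ^+ k) =
    fun m => series (fun k => k`!%:R^-1 *: A ^+ k) m +
      series (fun k => k`!%:R^-1 *: B ^+ k) m - series (exp_coeff 0) m *: 1.
  apply/funext => m; rewrite /series /= scaler_suml -sumrN -!big_split /=.
  apply: eq_bigr => -[|k] _; rewrite exp_coeff0 /=.
    by rewrite !expr0 fact0 invr1 !scale1r addrK.
  by rewrite scale0r subr0 E scalerDr.
rewrite -[X in _ - X]scale1r -[in X in _ --> X]expR0.
by apply: cvgB; [exact: cvgD|apply: cvgZr_tmp; exact: cvg_series_exp_coeff].
Qed.

End Exponential.

(** * Conjugation *)

Section Conj.
Variables (F : numFieldType) (n : nat).
Implicit Types K L V W B : 'M[F]_n.+1.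

(** The factors are the Rodrigues polynomials for $-s$ and $s$; $K^4=-K^2$ reduces their product. *)
Lemma rodrigues_inv K c s : c ^+ 2 + s ^+ 2 = 1 -> K * K * K = - K ->
  (1 - s *: K + (1 - c) *: (K * K)) * (1 + s *: K + (1 - c) *: (K * K)) = 1.
Proof.
move=> cs K3.
have K4 : K * K * (K * K) = - (K * K) by rewrite mulrA K3 mulNr.
have K3' : K * (K * K) = - K by rewrite mulrA.
rewrite !mulrDl !mulrDr !mul1r !mulr1 !mulNr -!scalerAl -!scalerAr K4 K3 K3'.
rewrite !scalerA !scalerN.
have -> : s * s = 1 - c ^+ 2 by rewrite -cs; ring.
move: (K * K) (1 : 'M[F]_n.+1) => S I.
by apply/matrixP => i j; rewrite !mxE; ring.
Qed.

(** Here $\mathrm{ad}_K^2W=-W$, so $K$ rotates $W$ towards $[K,W]$. Everything rests on $KWK=0$,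
    after which $K^2W+WK^2=-W$. *)
Lemma rodrigues_conj_moving K W D c s : K * K * K = - K ->
  D = K * W - W * K -> K * D - D * K = - W ->
  (1 + s *: K + (1 - c) *: (K * K)) * W * (1 - s *: K + (1 - c) *: (K * K))
  = c *: W + s *: D.
Proof.
move=> K3 -> ad2.
have K3r Z : Z * K * K * K = - (Z * K).
  by rewrite -!mulrA (mulrA K) K3 mulrN.
have e : K * K * W + W * K * K - K * W * K *+ 2 = - W.
  rewrite -ad2 mulrBr mulrBl !mulrA; move: (K * K * W) (W * K * K) (K * W * K).
  by move=> x y z; apply/matrixP => i j; rewrite !mxE; ring.
(* Multiplying [e] on both sides by [K], then by [K * K], forces [K * W * K = 0]. *)
have eK : K * K * W * K * K *+ 2 = - (K * W * K).
  have := congr1 (fun Z => K * Z * K) e.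
  rewrite !(mulrDl, mulrDr, mulrN, mulNr, mulrnAl, mulrnAr) !mulrA K3 !mulNr K3r.
  move: (K * K * W * K * K) (K * W * K) => x y.
  set l := (X in X = _ -> _) => E; apply/subr0_eq; transitivity (- y - l).
    by apply/matrixP => i j; rewrite !mxE; ring.
  by rewrite E subrr.
have eKK : K * K * W * K * K = - (K * W * K) *+ 2.
  have := congr1 (fun Z => K * K * Z * K * K) e.
  rewrite !(mulrDl, mulrDr, mulrN, mulNr, mulrnAl, mulrnAr) !mulrA K3.
  rewrite ?(mulrDl, mulrDr, mulrN, mulNr, mulrnAl, mulrnAr).
  rewrite K3r !(K3r (K * W)).
  move: (K * K * W * K * K) (K * W * K) => x y.
  set l := (X in X = _ -> _) => E; apply/subr0_eq; transitivity (- x - l).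
    by apply/matrixP => i j; rewrite !mxE; ring.
  by rewrite E subrr.
have KWK : K * W * K = 0.
  move: eK; rewrite eKK; move: (K * W * K) => y E.
  suff : 3%:R *: y = 0 by move/eqP; rewrite scaler_eq0 pnatr_eq0 /= => /eqP.
  rewrite -[RHS](subrr (- y)) -{2}E.
  by apply/matrixP => i j; rewrite !mxE; ring.
move: e; rewrite KWK mul0rn subr0 => e.
have -> : c *: W = W + (1 - c) *: (K * K * W + W * K * K).
  by rewrite e; apply/matrixP => i j; rewrite !mxE; ring.
rewrite !(mulrDl, mulrDr, mulrN, mulNr, mul1r, mulr1, =^~ scalerAl, =^~ scalerAr).
rewrite !mulrA.
have -> : K * K * W * K = 0 by rewrite -!mulrA (mulrA K W) KWK mulr0.
rewrite KWK !(mul0r, scaler0).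
by apply/matrixP => i j; rewrite !mxE; ring.
Qed.

(* [V + E] commutes with [K], while [- E] is rotated by [K]. *)
Lemma rodrigues_conj K V D E c s : c ^+ 2 + s ^+ 2 = 1 -> K * K * K = - K ->
  K * V - V * K = D -> K * D - D * K = E -> K * E - E * K = - D ->
  (1 + s *: K + (1 - c) *: (K * K)) * V =
  (V + s *: D + (1 - c) *: E) * (1 + s *: K + (1 - c) *: (K * K)).
Proof.
move=> cs K3 ad1 ad2 ad3.
have inv := rodrigues_inv cs K3.
set B := 1 + s *: K + _; set B' := 1 - s *: K + (1 - c) *: (K * K).
have inv' : B' * B = 1 := inv.
have inv2 : B * B' = 1.
  have sN : c ^+ 2 + (- s) ^+ 2 = 1 by rewrite sqrrN.
  by have := rodrigues_inv sN K3; rewrite !scaleNr opprK.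
suff E' : B * V * B' = V + s *: D + (1 - c) *: E.
  by rewrite -E' -(mulrA (B * V)) inv' mulr1.
have com : K * (V + E) = (V + E) * K.
  by apply/subr0_eq; rewrite mulrDr mulrDl opprD addrACA ad1 ad3 subrr.
have comB : B * (V + E) = (V + E) * B.
  have com2 : K * K * (V + E) = (V + E) * (K * K).
    by rewrite -mulrA com mulrA com mulrA.
  move: (V + E) com com2 => U com com2.
  by rewrite /B !mulrDl !mulrDr mul1r mulr1 -!scalerAl -!scalerAr com com2.
have rot : B * (- E) * B' = c *: (- E) + s *: D.
  apply: rodrigues_conj_moving => //.
    by rewrite mulrN mulNr -opprD ad3 opprK.
  by rewrite ad2 opprK.
have -> : B * V * B' = B * (V + E) * B' + B * (- E) * B'.
  by rewrite -mulrDl -mulrDr addrK.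
rewrite rot comB -(mulrA (V + E)) inv2 mulr1.
by apply/matrixP => i j; rewrite !mxE; ring.
Qed.

(** As $L^2=1$, the inverse of $c+sL$ is $c-sL$; expanding $(c+sL)V(c-sL)$ and using $c^2=1+s^2$
    gives the formula. *)
Lemma boost_conj L V c s : c ^+ 2 - s ^+ 2 = 1 -> L * L = 1 ->
  (c *: 1 + s *: L) * V =
  (V + (c * s) *: (L * V - V * L) + s ^+ 2 *: (V - L * V * L)) * (c *: 1 + s *: L).
Proof.
move=> cs L2.
have inv : (c *: 1 - s *: L) * (c *: 1 + s *: L) = 1.
  rewrite !(mulrDl, mulrDr, mulNr, mul1r, mulr1, =^~ scalerAl, =^~ scalerAr) L2.
  rewrite -[in RHS](scale1r 1) -cs.
  by move: (1 : 'M[F]_n.+1) => I; apply/matrixP => i j; rewrite !mxE; ring.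
set B := c *: 1 + s *: L in inv *; set B' := c *: 1 - s *: L in inv *.
suff E : B * V * B' = V + (c * s) *: (L * V - V * L) + s ^+ 2 *: (V - L * V * L).
  by rewrite -E -(mulrA (B * V)) inv mulr1.
rewrite /B /B'.
rewrite !(mulrDl, mulrDr, mulNr, mulrN, mul1r, mulr1, =^~ scalerAl, =^~ scalerAr).
move: (L * V) (V * L) (L * V * L) => x y z.
transitivity ((c ^+ 2 - s ^+ 2) *: V + (c * s) *: (x - y) + s ^+ 2 *: (V - z)).
  by apply/matrixP => i j; rewrite !mxE; ring.
by rewrite cs scale1r.
Qed.

End Conj.

(** * Matrices of brackets and conjugations on the one-vectors *)

Section Spin.
Variable R : realType.
Local Notation C := R[i].
Implicit Types (r : R) (T : 'M[C]_4) (X Y P : 'M[R]_5).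

Definition ad_mx (T : 'M[C]_4) X :=
  forall j, T *m Cl41_basis R j - Cl41_basis R j *m T = Cl41_comb X j.

Lemma Cl41_combD X Y j : Cl41_comb (X + Y) j = Cl41_comb X j + Cl41_comb Y j.
Proof.
by rewrite /Cl41_comb -big_split; apply: eq_bigr => i _; rewrite mxE rmorphD scalerDl.
Qed.

Lemma Cl41_combZ r X j : Cl41_comb (r *: X) j = r%:C%C *: Cl41_comb X j.
Proof.
by rewrite /Cl41_comb scaler_sumr; apply: eq_bigr => i _; rewrite mxE rmorphM scalerA.
Qed.

Lemma Cl41_comb1 j : Cl41_comb 1 j = Cl41_basis R j.
Proof.
rewrite /Cl41_comb (bigD1 j) //= big1 ?addr0 => [|i /negPf ij]; rewrite mxE ?eqxx ?scale1r //.
by rewrite ij scale0r.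
Qed.

Lemma Cl41_combM X Y j : Cl41_comb (X * Y) j = \sum_i (Y i j)%:C%C *: Cl41_comb X i.
Proof.
under [RHS]eq_bigr do rewrite /Cl41_comb scaler_sumr.
rewrite exchange_big; apply: eq_bigr => i _; rewrite mxE rmorph_sum scaler_suml.
by apply: eq_bigr => k _; rewrite scalerA rmorphM mulrC.
Qed.

(** Linearity extends the bracket from the basis to all one-vectors, so iterated brackets become
    powers of [X]. *)
Lemma ad_mx_lift T X Y : ad_mx T X ->
  forall j, T *m Cl41_comb Y j - Cl41_comb Y j *m T = Cl41_comb (X * Y) j.
Proof.
move=> TX j; rewrite Cl41_combM mulmx_sumr mulmx_suml -sumrB; apply: eq_bigr => i _.
by rewrite -scalemxAr -scalemxAl -scalerBr TX.
Qed.

(** Conjugation by [T] has matrix [P], written without an inverse so that explicit polynomials and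
    products can be checked directly. *)
Definition implements (T : 'M[C]_4) P :=
  forall j, T *m Cl41_basis R j = Cl41_comb P j *m T.

Lemma implementsM T T' P P' : implements T P -> implements T' P' ->
  implements (T *m T') (P *m P').
Proof.
move=> TP T'P' j; rewrite -mulmxA T'P' mulmxA /Cl41_comb mulmx_sumr -/(Cl41_comb _ _).
have -> : Cl41_comb (P *m P') j = Cl41_comb (P * P') j by [].
rewrite Cl41_combM mulmxA; congr (_ *m _); rewrite mulmx_suml; apply: eq_bigr => i _.
by rewrite -scalemxAr -scalemxAl TP.
Qed.

(** [rodrigues_conj] applies with $D$ and $E$ the one-vectors given by $X$ and $X^2$; $X^3=-X$
    closes the chain of brackets. *)
Lemma rodrigues_implements T X c s : c ^+ 2 + s ^+ 2 = 1 ->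
  T * T * T = - T -> X ^+ 3 = - X -> ad_mx T X ->
  implements (1 + s%:C%C *: T + (1 - c)%:C%C *: (T * T))
             (1 + s *: X + (1 - c) *: X ^+ 2).
Proof.
move=> cs T3 X3 TX j.
have adY Y k : T * Cl41_comb Y k - Cl41_comb Y k * T = Cl41_comb (X * Y) k.
  exact: ad_mx_lift.
rewrite !Cl41_combD !Cl41_combZ Cl41_comb1 rmorphB rmorph1.
apply: (rodrigues_conj _ T3 (TX j)).
- by rewrite -!rmorphXn -rmorphD cs.
- by rewrite adY.
- rewrite adY -exprS X3.
  by rewrite -scaleN1r Cl41_combZ rmorphN1 scaleN1r.
Qed.

Lemma boost_implements T X c s : c ^+ 2 - s ^+ 2 = 1 ->
  T * T = 1 -> ad_mx T X ->
  implements (c%:C%C *: 1 + s%:C%C *: T)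
             (1 + (c * s) *: X + (s ^+ 2 / 2) *: X ^+ 2).
Proof.
move=> cs T2 TX j.
have adY Y k : T * Cl41_comb Y k - Cl41_comb Y k * T = Cl41_comb (X * Y) k.
  exact: ad_mx_lift.
rewrite !Cl41_combD !Cl41_combZ Cl41_comb1.
(* As $T^2=1$, the double bracket is $2(V-TVT)$; hence the half in the coefficient of $X^2$. *)
have -> : (s ^+ 2 / 2)%:C%C *: Cl41_comb (X ^+ 2) j =
  s%:C%C ^+ 2 *: (Cl41_basis R j - T * Cl41_basis R j * T).
  have := adY X j; rewrite -TX -expr2 => <-; move: (Cl41_basis R j) => V.
  have -> : T * (T * V - V * T) - (T * V - V * T) * T = 2%:R *: (V - T * V * T).
    rewrite mulrBr mulrBl !mulrA T2 mul1r -(mulrA V) T2 mulr1.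
    by move: (T * V * T) => W; apply/matrixP => i l; rewrite !mxE; ring.
  by rewrite scalerA; congr (_ *: _); rewrite rmorphM fmorphV rmorphXn /= rmorph_nat mulfVK ?pnatr_eq0.
rewrite rmorphM -TX; apply: boost_conj => //.
by rewrite -!rmorphXn -rmorphB cs.
Qed.

End Spin.

(** * Invariance of the form $M$ *)

Section Unitary.
Variable R : realType.
Local Notation C := R[i].
Local Notation H := (quat R).
Implicit Types (r : R) (T : 'M[C]_4) (L A B : 'M[H]_2) (s : spin41_param R).

(** The derivative at the identity of the condition $Y^{*}MY=M$. *)
Definition infinitesimal T := T^t* *m formM R = - (formM R *m T).

Lemma spin41_dagger s :
  dagger (spin41_elt s) *m vH R (o5 4) = - (vH R (o5 4) *m spin41_elt s).
Proof.
rewrite spin41_eltE /dagger /vH /=.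
apply/matrixP; apply: ord2P; apply: ord2P; rewrite [RHS]mxE !mulmx2E !mxE /=;
apply: quatP => /=; ring.
Qed.

Lemma spin41_infinitesimal s : infinitesimal (Theta (spin41_elt s)).
Proof.
rewrite /infinitesimal.
rewrite formM_vH -Theta_dagger -scalemxAr -scalemxAl -!ThetaM -scalerN spin41_dagger.
by rewrite ThetaN.
Qed.

Lemma adjD (T T' : 'M[C]_4) : (T + T')^t* = T^t* + T'^t*.
Proof. by rewrite linearD /= map_mxD. Qed.

Lemma adjZ r T : (r%:C%C *: T)^t* = r%:C%C *: T^t*.
Proof.
by apply/matrixP => i j; rewrite !mxE rmorphM /=; congr (_ * _);
  apply/eqP; rewrite eq_complex /= oppr0 !eqxx.
Qed.

Lemma adjM (T T' : 'M[C]_4) : (T * T')^t* = T'^t* * T^t*.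
Proof. by rewrite trmx_mul map_mxM. Qed.

Lemma adj1 : (1 : 'M[C]_4)^t* = 1.
Proof. by rewrite trmx1 map_mx1. Qed.

(** Moving $B^{*}$ across $M$ changes the sign of $T$, which yields the inverse polynomial of
    [rodrigues_inv]. *)
Lemma rodrigues_unitary T (c s : R) : c ^+ 2 + s ^+ 2 = 1 ->
  T * T * T = - T -> infinitesimal T ->
  let B := 1 + s%:C%C *: T + (1 - c)%:C%C *: (T * T) in
  B^t* *m formM R *m B = formM R.
Proof.
move=> cs T3 /= inf.
have infE : T^t* * formM R = - (formM R * T) := inf.
have csC : (c%:C%C : C) ^+ 2 + s%:C%C ^+ 2 = 1 by rewrite -!rmorphXn -rmorphD cs.
have inv := rodrigues_inv csC T3.
rewrite !rmorphB rmorph1.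
set B := 1 + s%:C%C *: T + _; set B' := 1 - s%:C%C *: T + _ in inv.
have -> : B^t* *m formM R = formM R *m B'.
  change (B^t* * formM R = formM R * B').
  rewrite /B /B' -(rmorph1 (real_complex R)) -rmorphB !adjD !adjZ adjM adj1.
  rewrite !mulrDl !mulrDr mul1r mulr1 mulrN -!scalerAl -!scalerAr -mulrA infE.
  by rewrite mulrN mulrA infE mulNr opprK -mulrA scalerN.
by rewrite -mulmxA (inv : B' *m B = 1%:M) mulmx1.
Qed.

Lemma boost_unitary T (c s : R) : c ^+ 2 - s ^+ 2 = 1 ->
  T * T = 1 -> infinitesimal T ->
  let B := c%:C%C *: 1 + s%:C%C *: T in
  B^t* *m formM R *m B = formM R.
Proof.
move=> cs T2 /= inf.
have infE : T^t* * formM R = - (formM R * T) := inf.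
set B := c%:C%C *: 1 + s%:C%C *: T; pose B' := c%:C%C *: 1 - s%:C%C *: T.
have inv : B' * B = 1.
  rewrite /B /B'.
  rewrite !(mulrDl, mulrDr, mulNr, mul1r, mulr1, =^~ scalerAl, =^~ scalerAr) T2.
  have csC : (c%:C%C : C) ^+ 2 - s%:C%C ^+ 2 = 1 by rewrite -!rmorphXn -rmorphB cs.
  rewrite -[in RHS](scale1r 1) -csC.
  by move: (1 : 'M[C]_4) => I; apply/matrixP => i j; rewrite !mxE; ring.
have -> : B^t* *m formM R = formM R *m B'.
  change (B^t* * formM R = formM R * B').
  rewrite /B /B' !adjD !adjZ adj1 !mulrDl !mulrDr mulrN -!scalerAl -!scalerAr.
  by rewrite mul1r mulr1 infE scalerN.
by rewrite -mulmxA (inv : B' *m B = 1%:M) mulmx1.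
Qed.

Lemma Spin41M A B : Spin41 A -> Spin41 B -> Spin41 (A *m B).
Proof.
rewrite !Spin41E => EA EB.
have -> : dagger (A *m B) = dagger B *m dagger A.
  apply: Theta_inj; rewrite Theta_dagger !ThetaM !Theta_dagger.
  exact: adjM.
by rewrite -!mulmxA (mulmxA (vH R _) A) !(mulmxA (dagger A)) EA mulmxA.
Qed.

End Unitary.

(** * Explicit preimages of the two isoclinic parts *)

Section Explicit.
Variable R : realType.

(** Obtained by solving [Psi_mx s = pad0 (Y1mx p1 p2 p3)]: the zero fifth column forces $a_1=0$,
    $c=-b$ and $\gamma_l=\beta_l$. The second family arises likewise from [Y2mx]. *)
Definition Y1_param (p1 p2 p3 : R) := Spin41Param 0 (p2 / 2) (p2 / 2) (- p2 / 2)
  (- p1 / 2) (p3 / 2) (- p3 / 2) (- p1 / 2) (- p3 / 2) (- p1 / 2).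
Definition Y2_param (q1 q2 q3 : R) := Spin41Param 0 (q2 / 2) (- q2 / 2) (q2 / 2)
  (- q1 / 2) (q3 / 2) (q3 / 2) (q1 / 2) (q3 / 2) (q1 / 2).

Lemma Psi_Y1 p1 p2 p3 : Psi_mx (Y1_param p1 p2 p3) = pad0 (Y1mx p1 p2 p3).
Proof.
rewrite -[LHS](@submxK _ 4 1 4 1); apply: (f_equal4 (@block_mx R 4 1 4 1));
apply/matrixP => i j; rewrite !mxE /=;
case: i => [[|[|[|[|//]]]] Hi]; case: j => [[|[|[|[|//]]]] Hj] /=; try done; lra.
Qed.

Lemma Psi_Y2 q1 q2 q3 : Psi_mx (Y2_param q1 q2 q3) = pad0 (Y2mx q1 q2 q3).
Proof.
rewrite -[LHS](@submxK _ 4 1 4 1); apply: (f_equal4 (@block_mx R 4 1 4 1));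
apply/matrixP => i j; rewrite !mxE /=;
case: i => [[|[|[|[|//]]]] Hi]; case: j => [[|[|[|[|//]]]] Hj] /=; try done; lra.
Qed.

Lemma Y1_param_cube p1 p2 p3 :
  let L := spin41_elt (Y1_param p1 p2 p3) in
  L *m L *m L = (- (p1 ^+ 2 + p2 ^+ 2 + p3 ^+ 2))%:H *: L.
Proof.
rewrite /= spin41_eltE; apply/matrixP; apply: ord2P; apply: ord2P;
rewrite !mulmx2E !mxE /=; by apply: quatP => /=; field.
Qed.

Lemma Y2_param_cube p1 p2 p3 :
  let L := spin41_elt (Y2_param p1 p2 p3) in
  L *m L *m L = (- (p1 ^+ 2 + p2 ^+ 2 + p3 ^+ 2))%:H *: L.
Proof.
rewrite /= spin41_eltE; apply/matrixP; apply: ord2P; apply: ord2P;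
rewrite !mulmx2E !mxE /=; by apply: quatP => /=; field.
Qed.

(** In the basis $1,i,j,k$ of $\mathbf H$, [Y1mx] is left multiplication by the imaginary quaternion
    $p_1i+p_2j+p_3k$. *)
Lemma Y1mx_sqr (p1 p2 p3 : R) : Y1mx p1 p2 p3 *m Y1mx p1 p2 p3 =
  (- (p1 ^+ 2 + p2 ^+ 2 + p3 ^+ 2))%:M.
Proof.
apply/matrixP => i j; rewrite mxE !big_ord_recl big_ord0 !mxE.
by case: i => [[|[|[|[|//]]]] Hi]; case: j => [[|[|[|[|//]]]] Hj] /=; ring.
Qed.

(** In the same basis [Y2mx] is right multiplication by $-(q_1i+q_2j+q_3k)$. *)
Lemma Y2mx_sqr (q1 q2 q3 : R) : Y2mx q1 q2 q3 *m Y2mx q1 q2 q3 =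
  (- (q1 ^+ 2 + q2 ^+ 2 + q3 ^+ 2))%:M.
Proof.
apply/matrixP => i j; rewrite mxE !big_ord_recl big_ord0 !mxE.
by case: i => [[|[|[|[|//]]]] Hi]; case: j => [[|[|[|[|//]]]] Hj] /=; ring.
Qed.

(** Left and right multiplications commute by associativity of $\mathbf H$. *)
Lemma Y12mx_comm (p1 p2 p3 q1 q2 q3 : R) :
  Y1mx p1 p2 p3 *m Y2mx q1 q2 q3 = Y2mx q1 q2 q3 *m Y1mx p1 p2 p3.
Proof.
apply/matrixP => i j; rewrite !mxE !big_ord_recl !big_ord0 !mxE.
by case: i => [[|[|[|[|//]]]] Hi]; case: j => [[|[|[|[|//]]]] Hj] /=; ring.
Qed.

Lemma pad0M (A B : 'M[R]_4) : pad0 A * pad0 B = pad0 (A *m B).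
Proof.
rewrite -[LHS]/(pad0 A *m pad0 B) /pad0 (@mulmx_block _ 4 1 4 1 4 1).
by rewrite !mulmx0 !mul0mx !addr0.
Qed.

Lemma pad0D (A B : 'M[R]_4) : pad0 (A + B) = pad0 A + pad0 B.
Proof. by rewrite /pad0 (@add_block_mx _ 4 1 4 1) !addr0. Qed.

Lemma pad0Z (r : R) (A : 'M[R]_4) : pad0 (r *: A) = r *: pad0 A.
Proof. by rewrite /pad0 (@scale_block_mx _ 4 1 4 1) !scaler0. Qed.

End Explicit.

(** * Exponential of a sum of commuting isoclinic rotations *)

Section Isoclinic.
Variables (R : realType) (n : nat).

(* [J1 + J2] and [J1 - J2] annihilate each other, so each factor exponentiates separately. *)
Lemma exp_cvg_isoclinic (J1 J2 : 'M[R]_n.+1) x y :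
  J1 * J2 = J2 * J1 -> J2 * J2 = J1 * J1 ->
  J1 * J1 * J1 = - J1 -> J1 * J1 * J2 = - J2 ->
  exp_cvg (x *: J1 + y *: J2)
    ((1 + sin x *: J1 + (1 - cos x) *: J1 ^+ 2) *
     (1 + sin y *: J2 + (1 - cos y) *: J2 ^+ 2)).
Proof.
move=> com J22 J13 J112.
pose S := J1 * J1; pose K := J1 * J2.
have KJ1 : K * J1 = - J2 by rewrite /K -mulrA -com mulrA J112.
have KJ2 : K * J2 = - J1 by rewrite /K -mulrA J22 mulrA J13.
pose N1 := 2^-1 *: (J1 - J2); pose N2 := 2^-1 *: (J1 + J2).
have N11 : N1 * N1 = 2^-1 *: (S - K).
  rewrite /N1 -scalerAl -scalerAr mulrBl !mulrBr -com J22 -/S -/K.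
  by move: (S) (K) => s k; apply/matrixP => i j; rewrite !mxE; field.
have N22 : N2 * N2 = 2^-1 *: (S + K).
  rewrite /N2 -scalerAl -scalerAr mulrDl !mulrDr -com J22 -/S -/K.
  by move: (S) (K) => s k; apply/matrixP => i j; rewrite !mxE; field.
have N13 : N1 ^+ 3 = - N1.
  rewrite exprSr expr2 N11 /N1 -scalerAl -scalerAr mulrBl !mulrBr J13 J112 KJ1 KJ2.
  by apply/matrixP => i j; rewrite !mxE; field.
have N23 : N2 ^+ 3 = - N2.
  rewrite exprSr expr2 N22 /N2 -scalerAl -scalerAr mulrDl !mulrDr J13 J112 KJ1 KJ2.
  by apply/matrixP => i j; rewrite !mxE; field.
have N12 : N1 * N2 = 0.
  rewrite /N1 /N2 -scalerAl -scalerAr mulrBl !mulrDr -com J22 -/S -/K.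
  by move: (S) (K) => s k; apply/matrixP => i j; rewrite !mxE; field.
have N21 : N2 * N1 = 0.
  rewrite /N1 /N2 -scalerAl -scalerAr mulrDl !mulrBr -com J22 -/S -/K.
  by move: (S) (K) => s k; apply/matrixP => i j; rewrite !mxE; field.
(* [N1] and [N2] turn through the angles $x-y$ and $x+y$; the addition formulas below recover the
   product in $x$ and $y$. *)
have -> : x *: J1 + y *: J2 = (x - y) *: N1 + (x + y) *: N2.
  by apply/matrixP => i j; rewrite !mxE; field.
have O12 a b : a *: N1 * (b *: N2) = 0 by rewrite -scalerAl -scalerAr N12 !scaler0.
have O21 a b : a *: N2 * (b *: N1) = 0 by rewrite -scalerAl -scalerAr N21 !scaler0.
have := exp_cvg_orth (O12 _ _) (O21 _ _) (exp_cvg_sin (x := x - y) N13) (exp_cvg_sin (x := x + y) N23).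
rewrite !expr2 N11 N22 J22 -/S.
rewrite !(mulrDl, mulrDr, mul1r, mulr1, =^~ scalerAl, =^~ scalerAr).
have -> : S * S = - S by rewrite /S mulrA J13 mulNr.
have -> : J1 * S = - J1 by rewrite /S mulrA J13.
rewrite J112 -/K sinB sinD cosB cosD /N1 /N2.
congr exp_cvg; move: (S) (K) (1 : 'M[R]_n.+1) => S' K' I.
by apply/matrixP => i j; rewrite !mxE; field.
Qed.

End Isoclinic.

(** * The fibres *)

Section Main.
Variable R : realType.
Local Notation C := R[i].
Local Notation H := (quat R).
Implicit Types (A B K L : 'M[H]_2).

(** Normalization that also covers the zero vector; the clause on [t] lets $d=0$ give $t=0$ in the
    three-term version. *)
Lemma unit_direction (a b c d : R) :
  let m := Num.sqrt (a ^+ 2 + b ^+ 2 + c ^+ 2 + d ^+ 2) in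
  exists u v w t, [/\ [/\ a = m * u, b = m * v, c = m * w & d = m * t],
    u ^+ 2 + v ^+ 2 + w ^+ 2 + t ^+ 2 = 1 & t = d / m].
Proof.
move=> m.
have m2 : m ^+ 2 = a ^+ 2 + b ^+ 2 + c ^+ 2 + d ^+ 2.
  by rewrite sqr_sqrtr // !addr_ge0 // sqr_ge0.
have [m0|m0] := eqVneq m 0; last first.
  exists (a / m), (b / m), (c / m), (d / m).
  by split=> //; [split; field | rewrite !expr_div_n -!mulrDl -m2 divff // expf_neq0].
move: m2; rewrite m0 expr0n /= => m2.
have [a0 b0 c0 d0] : [/\ a = 0, b = 0, c = 0 & d = 0].
  by split; apply/eqP; rewrite -sqrf_eq0; apply/eqP; nra.
(* For $m=0$ any unit vector with $t=0$ serves, as $0/0$ is $0$ by convention. *)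
exists 1, 0, 0, 0; rewrite a0 b0 c0 d0 !mul0r.
by split=> //; rewrite expr1n !expr0n /= !addr0.
Qed.

Lemma mulmxZ_real (r : R) A B : A *m (r%:H *: B) = r%:H *: (A *m B).
Proof. by apply: Theta_inj; rewrite !(ThetaM, ThetaZ) -scalemxAr. Qed.

Lemma scale_realA (r r' : R) A : r%:H *: (r'%:H *: A) = (r * r')%:H *: A.
Proof. by apply: Theta_inj; rewrite !ThetaZ scalerA rmorphM. Qed.

(** The factors $m$ and $m^2$ clear the quotients; at $m=0$ both sides are the identity. *)
Lemma rodriguesZ m K : rodrigues m (m%:H *: K) =
  1%:M + (sin m)%:H *: K + (1 - cos m)%:H *: (K *m K).
Proof.
rewrite /rodrigues.
have -> : (m%:H *: K) ^+ 2 = (m ^+ 2)%:H *: (K *m K).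
  rewrite expr2 -[LHS]/((m%:H *: K) *m (m%:H *: K)) mulmxZ_real -scalemxAl.
  by rewrite scale_realA expr2.
rewrite !scale_realA /sinc /cosc2; have [->|m0] := eqVneq m 0.
  by rewrite sin0 cos0 expr0n /= subrr !mulr0.
by rewrite !divfK ?expf_neq0.
Qed.

Lemma Theta_quadratic K (r r' : R) :
  Theta (1%:M + r%:H *: K + r'%:H *: (K *m K)) =
  1 + r%:C%C *: Theta K + r'%:C%C *: (Theta K * Theta K).
Proof. by rewrite !ThetaD !ThetaZ Theta1 ThetaM. Qed.

Lemma rodrigues_spin41 s X (t : R) :
  let K := spin41_elt s in
  K *m K *m K = (-1)%:H *: K -> Psi_mx s = X -> X ^+ 3 = - X ->
  let B := 1%:M + (sin t)%:H *: K + (1 - cos t)%:H *: (K *m K) in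
  Spin41 B /\ implements (Theta B) (1 + sin t *: X + (1 - cos t) *: X ^+ 2).
Proof.
move=> K K3 KX X3 B.
have TB : Theta B = 1 + (sin t)%:C%C *: Theta K + (1 - cos t)%:C%C *: (Theta K * Theta K).
  exact: Theta_quadratic.
have T3 : Theta K * Theta K * Theta K = - Theta K.
  change (Theta K *m Theta K *m Theta K = - Theta K).
  by rewrite -!ThetaM K3 ThetaZ rmorphN1 scaleN1r.
have cs := cos2Dsin2 t.
split.
  change ((Theta B)^t* *m formM R *m Theta B = formM R).
  by rewrite TB; exact: (rodrigues_unitary cs T3 (spin41_infinitesimal s)).
rewrite TB; apply: rodrigues_implements => // j.
by rewrite ad_spin41_basis KX.
Qed.

(** $\mathrm{ad}_T^2V=2(V-TVT)$, and a third bracket gives $4\,\mathrm{ad}_TV$. *)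
Lemma ad_mx_cube (T : 'M[C]_4) X : T * T = 1 -> ad_mx T X -> X ^+ 3 = 4 *: X.
Proof.
move=> T2 TX; apply: Cl41_comb_inj => j.
have adY Y k : T * Cl41_comb Y k - Cl41_comb Y k * T = Cl41_comb (X * Y) k.
  exact: ad_mx_lift.
have TX' : T * Cl41_basis R j - Cl41_basis R j * T = Cl41_comb X j := TX j.
rewrite 2!exprS expr1 Cl41_combZ -!adY -TX'; move: (Cl41_basis R j) => V.
rewrite !(mulrBr, mulrBl) !mulrA T2 !mul1r.
rewrite -?(mulrA V) ?T2 ?mulr1 -?(mulrA (T * V)) ?T2 ?mulr1.
rewrite mul1r rmorph_nat.
by move: (T * V) (V * T) => x y; apply/matrixP => i l; rewrite !mxE; ring.
Qed.

(** * Symmetric elements of $so(4,1)$ and rescaling of parameters *)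

Definition boost_param (a b be1 be2 : R) :=
  Spin41Param a 0 b b 0 0 be1 be2 (- be1) (- be2).

(** With $\varepsilon$ the diagonal of $I_{4,1}$, symmetry gives
    $Q_{ij}\varepsilon_j=-\varepsilon_iQ_{ij}$, so entries with $\varepsilon_i=\varepsilon_j$
    vanish. *)
Lemma so41_symP (Q : 'M[R]_5) : so41 Q -> Q^T = Q ->
  exists a b be1 be2, Q = Psi_mx (boost_param a b be1 be2).
Proof.
move=> Qso Qs.
have e i j : Q i j * [:: 1; 1; 1; 1; -1]`_j = - ([:: 1; 1; 1; 1; -1]`_i * Q i j).
  by move: Qso => /matrixP/(_ i j); rewrite Qs mul_mx_diag mul_diag_mx !mxE.
have sym i j : Q i j = Q j i by rewrite -{1}Qs mxE.
have Z (i j : 'I_5) : [:: 1; 1; 1; 1; -1 : R]`_i = [:: 1; 1; 1; 1; -1]`_j -> Q i j = 0.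
  move=> eij; have := e i j; rewrite eij => Eij.
  have : [:: 1; 1; 1; 1; -1]`_j * Q i j = 0 by lra.
  case: j {eij Eij} => [[|[|[|[|[|//]]]]] Hj] /= ?; lra.
(* The fifth column of [Psi_mx] is here $(-2a,-2\beta_2,2b,-2\beta_1,0)$. *)
exists (- Q (o5 0) (o5 4) / 2), (Q (o5 2) (o5 4) / 2),
  (- Q (o5 3) (o5 4) / 2), (- Q (o5 1) (o5 4) / 2).
apply/matrixP => i j; rewrite [RHS]mxE.
case: i => [[|[|[|[|[|//]]]]] Hi]; case: j => [[|[|[|[|[|//]]]]] Hj] /=;
  rewrite (_ : Hi = isT) 1?(_ : Hj = isT); try exact: bool_irrelevance;
  try (rewrite Z //; lra); try (rewrite (sym (o5 4)); lra).
all: lra.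
Qed.

Lemma boost_param_sqr (a b be1 be2 : R) :
  let L := spin41_elt (boost_param a b be1 be2) in
  L *m L = (a ^+ 2 + b ^+ 2 + be1 ^+ 2 + be2 ^+ 2)%:H%:M.
Proof.
rewrite /= spin41_eltE; apply/matrixP; apply: ord2P; apply: ord2P;
by rewrite !mulmx2E !mxE /=; apply: quatP => /=; ring.
Qed.

Definition scale_param (m : R) (s : spin41_param R) :=
  let: Spin41Param a1 a2 b c al1 al2 be1 be2 ga1 ga2 := s in
  Spin41Param (m * a1) (m * a2) (m * b) (m * c) (m * al1) (m * al2)
    (m * be1) (m * be2) (m * ga1) (m * ga2).

Lemma spin41_elt_scale m s : spin41_elt (scale_param m s) = m%:H *: spin41_elt s.
Proof.
rewrite !spin41_eltE; apply/matrixP; case: s => *.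
by apply: ord2P; apply: ord2P; rewrite !mxE /=; apply: quatP => /=; ring.
Qed.

Lemma Psi_mx_scale m s : Psi_mx (scale_param m s) = m *: Psi_mx s.
Proof.
apply/matrixP => i j; case: s => *; rewrite !mxE.
case: i => [[|[|[|[|[|//]]]]] Hi]; case: j => [[|[|[|[|[|//]]]]] Hj] /=; ring.
Qed.

Lemma Y1_param_scale (m u v w : R) :
  Y1_param (m * u) (m * v) (m * w) = scale_param m (Y1_param u v w).
Proof. by rewrite /Y1_param /=; congr Spin41Param; ring. Qed.

Lemma Y2_param_scale (m u v w : R) :
  Y2_param (m * u) (m * v) (m * w) = scale_param m (Y2_param u v w).
Proof. by rewrite /Y2_param /=; congr Spin41Param; ring. Qed.

(** The factor $2$ in [kappa] cancels the halves in [Y1_param]. *)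
Lemma kappa_Y1 (p1 p2 p3 : R) :
  kappa (Y1_param p1 p2 p3) = Num.sqrt (p1 ^+ 2 + p2 ^+ 2 + p3 ^+ 2).
Proof.
rewrite /kappa -[2 in LHS](@ger0_norm R) // -sqrtr_sqr -sqrtrM ?sqr_ge0 //.
by congr Num.sqrt; rewrite /=; field.
Qed.

Lemma kappa_Y2 (p1 p2 p3 : R) :
  kappa (Y2_param p1 p2 p3) = Num.sqrt (p1 ^+ 2 + p2 ^+ 2 + p3 ^+ 2).
Proof.
rewrite /kappa -[2 in LHS](@ger0_norm R) // -sqrtr_sqr -sqrtrM ?sqr_ge0 //.
by congr Num.sqrt; rewrite /=; field.
Qed.

Lemma unit_direction3 (a b c : R) :
  let m := Num.sqrt (a ^+ 2 + b ^+ 2 + c ^+ 2) in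
  exists u v w, [/\ a = m * u, b = m * v, c = m * w & u ^+ 2 + v ^+ 2 + w ^+ 2 = 1].
Proof.
move=> m; have [u [v [w [t []]]]] := unit_direction a b c 0.
rewrite expr0n addr0 mul0r -/m => -[au bv cw _] + t0.
by rewrite t0 expr0n addr0 => uvw; exists u, v, w.
Qed.

Lemma pad0N (A : 'M[R]_4) : pad0 (- A) = - pad0 A.
Proof. by rewrite -[- A]scaleN1r pad0Z scaleN1r. Qed.

Lemma boost_fiber (Q : 'M[R]_5) : so41 Q -> Q^T = Q -> expmx Q != 0 ->
  exists a1 b beta1 beta2 : R,
     let Lambda : 'M[quat R]_2 := seqmx 2 2
       [:: [:: a1%:H; b%:H + beta1%:H * quat_j + beta2%:H * quat_k];
           [:: b%:H - beta1%:H * quat_j - beta2%:H * quat_k; - a1%:H]] in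
     let lambda := Num.sqrt (a1 ^+ 2 + b ^+ 2 + beta1 ^+ 2 + beta2 ^+ 2) in
     let B := (cosh lambda)%:H%:M + (sinhc lambda)%:H *: Lambda in
     @spin41 R `&` @Psi41 R @^-1` [set Q] = [set Lambda] /\
     @Spin41 R `&` @Phi41 R @^-1` [set expmx Q] = [set B; - B].
Proof.
move=> Qso Qs P0; have [a [b [be1 [be2 QE]]]] := so41_symP Qso Qs.
exists a, b, be1, be2 => Lambda m B.
have LE : Lambda = spin41_elt (boost_param a b be1 be2).
  rewrite spin41_eltE; apply/matrixP; apply: ord2P; apply: ord2P;
  by rewrite !mxE /=; apply: quatP => /=; ring.
split; first by rewrite QE LE Psi41_fiber.
have [u [v [w [t [[]]]]]] := unit_direction a b be1 be2.
rewrite -/m => au bv cw dt uvwt _.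
pose s := boost_param u v w t; pose L := spin41_elt s; pose X := Psi_mx s.
have sE : boost_param a b be1 be2 = scale_param m s.
  by rewrite /s /boost_param au bv cw dt /=; congr Spin41Param; ring.
have L2 : Theta L * Theta L = 1.
  by change (Theta L *m Theta L = 1%:M); rewrite -ThetaM boost_param_sqr uvwt Theta1.
have adL : ad_mx (Theta L) X by move=> j; exact: ad_spin41_basis.
have X3 : X ^+ 3 = 4 *: X := ad_mx_cube L2 adL.
(* $X^3=4X$ allows the eigenvalues $0,\pm2$; halving prepares for [exp_cvg_sinh]. *)
pose N := 2^-1 *: X.
have N3 : N ^+ 3 = N.
  by rewrite /N exprZn X3 scalerA; congr (_ *: _); field.
have cs : cosh m ^+ 2 - sinh m ^+ 2 = 1.
  rewrite /cosh /sinh; have := expRxMexpNx_1 m; move: (expR m) (expR (- m)) => x y xy.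
  by transitivity (x * y); [field | rewrite xy].
(* Since $Q=2mN$, the double-argument formulas turn $\sinh 2m$ and $\cosh 2m-1$ into the
   coefficients of [boost_implements]. *)
have PE : expmx Q = 1 + (cosh m * sinh m) *: X + (sinh m ^+ 2 / 2) *: X ^+ 2.
  have -> : Q = (2 * m) *: N.
    by rewrite QE sE Psi_mx_scale /N scalerA -/X; congr (_ *: _); field.
  rewrite (expmxE (exp_cvg_sinh (x := 2 * m) N3)) /N exprZn !scalerA /sinh /cosh.
  have -> : expR (2 * m) = expR m ^+ 2 by rewrite mulr_natl mulr2n expRD expr2.
  have -> : expR (- (2 * m)) = expR (- m) ^+ 2 by rewrite mulr_natl mulr2n opprD expRD expr2.
  have := expRxMexpNx_1 m; move: (expR m) (expR (- m)) => x y xy.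
  congr (_ + _ *: _ + _ *: _); [by field |].
  transitivity (((x ^+ 2 + y ^+ 2) / 2 - x * y) * 2^-1 ^+ 2); [by rewrite xy | by field].
have BE : Theta B = (cosh m)%:C%C *: 1 + (sinh m)%:C%C *: Theta L.
  rewrite ThetaD -scalemx1 LE sE spin41_elt_scale scale_realA !ThetaZ Theta1.
  congr (_ + _%:C%C *: _); rewrite /sinhc; have [->|m0] := eqVneq m 0; last by rewrite divfK.
  by rewrite mulr0 /sinh oppr0 expR0 subrr mul0r.
apply: Phi41_fiber => //.
  change ((Theta B)^t* *m formM R *m Theta B = formM R).
  by rewrite BE; exact: (boost_unitary cs L2 (spin41_infinitesimal s)).
by rewrite PE BE; exact: boost_implements.
Qed.

(** [pad0 J] squares to $-1$ only on the $4\times4$ block, hence the third, padded factor. *)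
Lemma pad0_cube (J J' : 'M[R]_4) : J *m J = - 1%:M ->
  pad0 J * pad0 J * pad0 J' = - pad0 J'.
Proof. by move=> J2; rewrite !pad0M J2 mulNmx mul1mx pad0N. Qed.

(** Each factor is normalized and lifted separately; the product of the lifts then induces the
    product form of [V]. *)
Lemma rotation_fiber (p1 p2 p3 q1 q2 q3 : R) :
  let V := expmx (pad0 (Y1mx p1 p2 p3 + Y2mx q1 q2 q3)) in
  V != 0 ->
  let s1 := Y1_param p1 p2 p3 in let s2 := Y2_param q1 q2 q3 in
  let B := rodrigues (kappa s1) (spin41_elt s1) *m
           rodrigues (kappa s2) (spin41_elt s2) in
  @Spin41 R `&` @Phi41 R @^-1` [set V] = [set B; - B].
Proof.
move=> V V0 /=.
have [u [v [w []]]] := unit_direction3 p1 p2 p3.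
have [u' [v' [w' []]]] := unit_direction3 q1 q2 q3.
rewrite -(kappa_Y1 p1 p2 p3) -(kappa_Y2 q1 q2 q3).
set x := kappa (Y1_param _ _ _); set y := kappa (Y2_param _ _ _).
move=> q1E q2E q3E n2 p1E p2E p3E n1; clearbody x y.
have Y1E : Y1mx p1 p2 p3 = x *: Y1mx u v w.
  rewrite p1E p2E p3E; apply/matrixP => i j; rewrite !mxE.
  by case: i => [[|[|[|[|//]]]] Hi]; case: j => [[|[|[|[|//]]]] Hj] /=; ring.
have Y2E : Y2mx q1 q2 q3 = y *: Y2mx u' v' w'.
  rewrite q1E q2E q3E; apply/matrixP => i j; rewrite !mxE.
  by case: i => [[|[|[|[|//]]]] Hi]; case: j => [[|[|[|[|//]]]] Hj] /=; ring.
have S1 : Y1mx u v w *m Y1mx u v w = - 1%:M by rewrite Y1mx_sqr n1 rmorphN.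
have S2 : Y2mx u' v' w' *m Y2mx u' v' w' = - 1%:M by rewrite Y2mx_sqr n2 rmorphN.
pose J1 := pad0 (Y1mx u v w); pose J2 := pad0 (Y2mx u' v' w').
have VE : V = (1 + sin x *: J1 + (1 - cos x) *: J1 ^+ 2) *
              (1 + sin y *: J2 + (1 - cos y) *: J2 ^+ 2).
  rewrite /V Y1E Y2E pad0D !pad0Z; apply: expmxE; apply: exp_cvg_isoclinic.
  - by rewrite !pad0M Y12mx_comm.
  - by rewrite !pad0M S1 S2.
  - exact: pad0_cube.
  - exact: pad0_cube.
have [SB1 IB1] : Spin41 (rodrigues x (spin41_elt (Y1_param p1 p2 p3))) /\
    implements (Theta (rodrigues x (spin41_elt (Y1_param p1 p2 p3))))
      (1 + sin x *: J1 + (1 - cos x) *: J1 ^+ 2).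
  rewrite p1E p2E p3E Y1_param_scale spin41_elt_scale rodriguesZ.
  apply: rodrigues_spin41; first by rewrite Y1_param_cube n1.
    exact: Psi_Y1.
  by rewrite exprSr expr2; exact: pad0_cube.
have [SB2 IB2] : Spin41 (rodrigues y (spin41_elt (Y2_param q1 q2 q3))) /\
    implements (Theta (rodrigues y (spin41_elt (Y2_param q1 q2 q3))))
      (1 + sin y *: J2 + (1 - cos y) *: J2 ^+ 2).
  rewrite q1E q2E q3E Y2_param_scale spin41_elt_scale rodriguesZ.
  apply: rodrigues_spin41; first by rewrite Y2_param_cube n2.
    exact: Psi_Y2.
  by rewrite exprSr expr2; exact: pad0_cube.
apply: Phi41_fiber => //; first exact: Spin41M.
rewrite VE ThetaM; exact: implementsM.
Qed.

End Main.

Theorem mainTheorem10 (R : realType) (X V P Q : 'M[R]_5)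
    (p1 p2 p3 q1 q2 q3 : R) :
  SOplus41 X -> X = V *m P ->
  special_orthogonal V -> positive_definite P -> SOplus41 V -> SOplus41 P ->
  so41 Q -> Q^T = Q -> expmx Q = P ->
  V = expmx (pad0 (Y1mx p1 p2 p3 + Y2mx q1 q2 q3)) ->
  (exists a1 b beta1 beta2 : R,
     let Lambda : 'M[quat R]_2 := seqmx 2 2
       [:: [:: a1%:H; b%:H + beta1%:H * quat_j + beta2%:H * quat_k];
           [:: b%:H - beta1%:H * quat_j - beta2%:H * quat_k; - a1%:H]] in
     let lambda := Num.sqrt (a1 ^+ 2 + b ^+ 2 + beta1 ^+ 2 + beta2 ^+ 2) in
     let B := (cosh lambda)%:H%:M + (sinhc lambda)%:H *: Lambda in
     @spin41 R `&` @Psi41 R @^-1` [set Q] = [set Lambda] /\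
     @Spin41 R `&` @Phi41 R @^-1` [set P] = [set B; - B]) /\
  (exists s1 s2 : spin41_param R,
     let A1 := spin41_elt s1 in
     let A2 := spin41_elt s2 in
     let B := rodrigues (kappa s1) A1 *m rodrigues (kappa s2) A2 in
     [/\ @spin41 R `&` @Psi41 R @^-1` [set pad0 (Y1mx p1 p2 p3)] = [set A1],
         @spin41 R `&` @Psi41 R @^-1` [set pad0 (Y2mx q1 q2 q3)] = [set A2] &
         @Spin41 R `&` @Phi41 R @^-1` [set V] = [set B; - B]]).
Proof.
move=> _ _ [VV _] [_ Ppos] _ _ Qso Qs QP VE; split.
  rewrite -QP; apply: boost_fiber => //; rewrite QP; apply/eqP => P0.
  (* Positivity at the all-ones vector excludes $P=0$. *)
  have x0 : const_mx 1 != 0 :> 'cV[R]_5.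
    by apply/eqP => /matrixP/(_ 0 0)/eqP; rewrite !mxE oner_eq0.
  by have := Ppos _ x0; rewrite P0 mulmx0 mul0mx mxE ltxx.
exists (Y1_param p1 p2 p3), (Y2_param q1 q2 q3); split.
- by rewrite -Psi_Y1 Psi41_fiber.
- by rewrite -Psi_Y2 Psi41_fiber.
(* Orthogonality, $V^TV=I$, excludes $V=0$. *)
rewrite VE; apply: rotation_fiber; rewrite -VE; apply/eqP => V0.
by move: VV; rewrite V0 mulmx0 => /matrixP/(_ 0 0)/eqP; rewrite !mxE eq_sym oner_eq0.
Qed.
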